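(* Let $f\colon\mathbb{Z}\to\mathbb{R}$ be a bounded generalised polynomial map and let $d\in\mathbb{N}$. Then there exist a connected, simply connected nilpotent Lie group $G$, a lattice $\Gamma<G$, a filtration $G_\bullet$ on $G$ (with a compatible Mal'cev basis), and a piecewise polynomial map $F\colon G/\Gamma\to\mathbb{R}$ such that for each polynomial $p\in\mathbb{R}[x]$ with $\deg p\le d$ there exists $g_p\in\mathrm{poly}(\mathbb{Z},G_\bullet)$ with $f(\lfloor p(n)\rfloor) = F(g_p(n)\Gamma)$ for all $n\in\mathbb{Z}$.
   Context: A generalised polynomial map $\mathbb{Z}\to\mathbb{R}$ is the restriction to $\mathbb{Z}$ of an element of the smallest family of maps $\mathbb{R}\to\mathbb{R}$ containing polynomials and closed under pointwise sum, product and integer part. A lattice is a discrete cocompact subgroup. A filtration of degree $s$ on $G$ is a sequence of subgroups $G=G_0=G_1\ge G_2\ge\dots$ with $G_{s+1}=\{e\}$ and $[G_i,G_j]\subset G_{i+j}$. A Mal'cev basis compatible with $\Gamma$ and $G_\bullet$ is a basis $X_1,\dots,X_D$ of the Lie algebra $\mathfrak g$ such that each $\mathrm{span}(X_{j+1},\dots,X_D)$ is an ideal, each $g\in G_i$ is uniquely $\exp(t_{D(i)+1}X_{D(i)+1})\cdots\exp(t_DX_D)$ with $D(i)=\operatorname{codim}G_i$, and $\Gamma$ is the set of products $\exp(t_1X_1)\cdots\exp(t_DX_D)$ with $t_j\in\mathbb{Z}$; it induces coordinates $\tau\colon G/\Gamma\to[0,1)^D$ via $x=\exp(\tau_1(x)X_1)\cdots\exp(\tau_D(x)X_D)\Gamma$.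 A subset of $G/\Gamma$ is semialgebraic if its image under $\tau$ is a finite union of sets of the form $\{x: P_1(x)>0,\dots,P_n(x)>0,Q_1(x)=0,\dots,Q_m(x)=0\}$ with real polynomials $P_i,Q_j$. $F$ is piecewise polynomial if there are a partition of $G/\Gamma$ into finitely many semialgebraic sets $S_i$ and polynomials $\Phi_i$ with $F(x)=\Phi_i(\tau(x))$ for $x\in S_i$. $\mathrm{poly}(\mathbb{Z},G_\bullet)$ is the set of maps $g(n)=g_0g_1^{n}g_2^{\binom n2}\cdots g_s^{\binom ns}$ with $g_i\in G_i$. *)

(* Defs.v *)
From HB Require Import structures.
From mathcomp Require Import all_boot all_order all_algebra.
From mathcomp Require Import reals.
From mathcomp Require mpoly.
Set Implicit Arguments.
Unset Strict Implicit.
Unset Printing Implicit Defensive.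
Import Order.TTheory GRing.Theory Num.Theory.
Local Open Scope ring_scope.

Section GenPoly.
Variable R : realType.

Inductive is_gen_poly_fun : (R -> R) -> Prop :=
  | gpf_poly (p : {poly R}) : is_gen_poly_fun (fun x => p.[x])
  | gpf_add (u v : R -> R) : is_gen_poly_fun u -> is_gen_poly_fun v ->
      is_gen_poly_fun (fun x => u x + v x)
  | gpf_mul (u v : R -> R) : is_gen_poly_fun u -> is_gen_poly_fun v ->
      is_gen_poly_fun (fun x => u x * v x)
  | gpf_floor (u : R -> R) : is_gen_poly_fun u ->
      is_gen_poly_fun (fun x => (Num.floor (u x))%:~R).

Definition gen_poly_map (f : int -> R) : Prop :=
  exists u, is_gen_poly_fun u /\ forall n : int, f n = u n%:~R.

Definition bounded_map (f : int -> R) : Prop :=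
  exists M : R, forall n : int, `|f n| <= M.
End GenPoly.

Section NilGroup.
Variables (R : realType) (N D : nat).
(* matrices of size N.+1 (so that they form a unit ring) *)
Local Notation mx := ('M[R]_N.+1).
Variable X : 'I_D -> mx.

(** matrix exponential (a finite sum on strictly upper triangular matrices) *)
Definition mexp (A : mx) : mx := \sum_(k < N.+2) (k`!%:R)^-1 *: A ^+ k.

Definition strictly_upper (A : mx) : Prop :=
  forall i j : 'I_N.+1, (j <= i)%N -> A i j = 0.

Definition span_from (j : nat) (A : mx) : Prop :=
  exists c : 'I_D -> R, (forall k : 'I_D, (k < j)%N -> c k = 0) /\
    A = \sum_(k < D) c k *: X k.

Definition lie_bracket (A B : mx) : mx := A * B - B * A.

(** X is a basis of a Lie algebra g of strictly upper triangular matrices,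
    with each span(X_j,...,X_{D-1}) an ideal of g (j = 0 : g is a Lie algebra) *)
Definition nilpotent_lie_basis : Prop :=
  [/\ forall k, strictly_upper (X k),
      forall c : 'I_D -> R, \sum_(k < D) c k *: X k = 0 -> forall k, c k = 0
    & forall j A B, span_from 0 A -> span_from j B ->
        span_from j (lie_bracket A B)].

(** the connected simply connected nilpotent Lie group G = exp(g) *)
Definition lie_group (g : mx) : Prop := exists A, span_from 0 A /\ g = mexp A.

Definition malcev_prod (j : nat) (t : 'I_D -> R) : mx :=
  \prod_(k < D | (j <= k)%N) mexp (t k *: X k).

Definition malcev_lattice (g : mx) : Prop :=
  exists z : 'I_D -> int, g = malcev_prod 0 (fun k => (z k)%:~R).

Definition subgroup_of (H K : mx -> Prop) : Prop :=
  [/\ forall g, H g -> K g, H 1,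
      forall g h, H g -> H h -> H (g * h)
    & forall g, H g -> H (g^-1)].

Definition mx_bounded (M : R) (g : mx) : Prop := forall i j, `|g i j| <= M.

Definition is_lattice (Gam : mx -> Prop) : Prop :=
  [/\ subgroup_of Gam lie_group,
      exists e : R, 0 < e /\ forall gam, Gam gam ->
        (forall i j, `|(gam - 1) i j| < e) -> gam = 1
    & exists M : R, forall g, lie_group g ->
        exists k gam, [/\ lie_group k, Gam gam, mx_bounded M k & g = k * gam]].

Definition filtration (s : nat) (Gf : nat -> mx -> Prop) : Prop :=
  [/\ (forall g, Gf 0%N g <-> lie_group g) /\
        (forall g, Gf 1%N g <-> lie_group g),
      (forall i, subgroup_of (Gf i) lie_group),
      (forall i g, Gf i.+1 g -> Gf i g),
      (forall i g, (s < i)%N -> (Gf i g <-> g = 1))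
    & forall i j g h, Gf i g -> Gf j h -> Gf (i + j)%N (g^-1 * h^-1 * g * h)].

(** X is a Mal'cev basis compatible with Gamma = malcev_lattice and Gf:
    Dc i plays the role of D(i) = codim G_i *)
Definition malcev_compatible (Gf : nat -> mx -> Prop) (Dc : nat -> nat) : Prop :=
  [/\ nilpotent_lie_basis,
      forall i, (Dc i <= D)%N,
      forall i g, Gf i g <-> exists t, g = malcev_prod (Dc i) t
    & forall i t t', malcev_prod (Dc i) t = malcev_prod (Dc i) t' ->
        forall k : 'I_D, (Dc i <= k)%N -> t k = t' k].

(** semialgebraic subsets of R^D: finite unions of basic sets
    {P_1 > 0, ..., P_a > 0, Q_1 = 0, ..., Q_b = 0} *)
Definition semialg := seq (seq (mpoly.mpoly D R) * seq (mpoly.mpoly D R)).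

Definition in_semialg (S : semialg) (t : 'I_D -> R) : bool :=
  has (fun PQ => all (fun P => 0 < mpoly.meval t P) PQ.1 &&
                 all (fun Q => mpoly.meval t Q == 0) PQ.2) S.

Definition unit_cube (t : 'I_D -> R) : Prop := forall k, 0 <= t k < 1.

(** F : G/Gamma -> R (given as a function on G whose value at g is F(g Gamma))
    is piecewise polynomial: a partition of G/Gamma into finitely many sets S_i
    with tau(S_i) semialgebraic, and polynomials Phi_i with
    F(x) = Phi_i(tau(x)) on S_i.  A point x = g Gamma with tau(x) = t is
    written malcev_prod 0 t * gam, t in [0,1)^D, gam in Gamma. *)
Definition piecewise_poly (F : mx -> R) : Prop :=
  exists (m : nat) (S : 'I_m -> semialg) (Phi : 'I_m -> mpoly.mpoly D R),
    forall t, unit_cube t ->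
      exists i : 'I_m,
        [/\ in_semialg (S i) t,
            forall i', in_semialg (S i') t -> i' = i
          & forall gam, malcev_lattice gam ->
              F (malcev_prod 0 t * gam) = mpoly.meval t (Phi i)].

Definition binz (n : int) (k : nat) : int :=
  ((\prod_(i < k) (n - i%:Z)) %/ (k`!)%:Z)%Z.

Definition poly_seq (s : nat) (Gf : nat -> mx -> Prop) (gp : int -> mx) : Prop :=
  exists g : nat -> mx, (forall i, (i <= s)%N -> Gf i (g i)) /\
    forall n : int, gp n = \prod_(i < s.+1) (g i) ^ (binz n i).
End NilGroup.

(* Main.v *)
Require Import Defs.
From HB Require Import structures.
From mathcomp Require Import all_boot all_order all_algebra.
From mathcomp Require Import boolp reals.
From mathcomp Require mpoly mxtens.
From mathcomp Require Import zify ring lra.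
Import Order.TTheory GRing.Theory Num.Theory.
Set Implicit Arguments.
Unset Strict Implicit.
Unset Printing Implicit Defensive.
Local Open Scope ring_scope.

(** Take for [G] a group of unitriangular matrices and for [Gamma] its integer
    points.  Every [g] in [G] factors uniquely as [g = k m] with [m] in [Gamma] and
    the entries of [k] above the diagonal in [0,1); call these entries, along a matrix
    of polynomials [g(n)], nil entries.  Kronecker products [k (x) k'] show that products
    of nil entries are nil entries, and prepending to [g] the polynomial [P] times one
    of its rows shows that the fractional part of [P * k_ij] is again a nil entry.
    Hence finite sums of terms [chi * P * kappa], with [chi] a 0/1-valued piecewise
    polynomial function of nil entries, [P] a polynomial and [kappa] a nil entry, are
    closed under sum, product and integer part, so they contain all generalised
    polynomials; the bounded ones are piecewise polynomial in nil entries.  All this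
    is uniform in the coefficients of the polynomials, only their degrees matter.

    Weighting the entry [(a,b)] by [phi a - phi b], with [phi] rapidly decreasing,
    gives a filtration for which any matrix of polynomials of the right degrees is a
    polynomial sequence (Taylor expansion), and ordering the elementary matrices by
    weight gives a Mal'cev basis whose coordinates are the matrix entries. *)

(** * Matrices filtered by a weight on the entries *)

Section Weight.
Variables (K : nzRingType) (N : nat) (phi : 'I_N.+1 -> nat).
Local Notation mx := ('M[K]_N.+1).

(** The additive form avoids the truncated difference [phi a - phi b], which would give weight [0]
    to entries with [phi a < phi b]. *)
Definition wt (i : nat) (A : mx) := forall a b, (phi a < phi b + i)%N -> A a b = 0.

Lemma wt0 i : wt i 0.
Proof. by move=> a b _; rewrite mxE. Qed.

Lemma wtD i A B : wt i A -> wt i B -> wt i (A + B).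
Proof. by move=> hA hB a b h; rewrite mxE hA // hB // addr0. Qed.

Lemma wtN i A : wt i A -> wt i (- A).
Proof. by move=> hA a b h; rewrite mxE hA // oppr0. Qed.

Lemma wtB i A B : wt i A -> wt i B -> wt i (A - B).
Proof. by move=> hA hB; apply: wtD => //; apply: wtN. Qed.

Lemma wtZ i c A : wt i A -> wt i (c *: A).
Proof. by move=> hA a b h; rewrite mxE hA // mulr0. Qed.

Lemma wt_sum i (I : Type) (r : seq I) (P : pred I) (A : I -> mx) :
  (forall l, P l -> wt i (A l)) -> wt i (\sum_(l <- r | P l) A l).
Proof. by move=> hA; elim/big_ind: _ => //; [apply: wt0 | apply: wtD]. Qed.

Lemma wtM i j A B : wt i A -> wt j B -> wt (i + j) (A * B).
Proof.
move=> hA hB a b h; rewrite mxE big1 // => c _.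
case: (ltnP (phi a) (phi c + i)) => h1; first by rewrite hA // mul0r.
rewrite hB ?mulr0 //; lia.
Qed.

Lemma wtW i j A : (i <= j)%N -> wt j A -> wt i A.
Proof. by move=> hij hA a b h; apply: hA; lia. Qed.

Lemma wt1 : wt 0 1.
Proof. by move=> a b; rewrite mxE; case: eqP => // ->; lia. Qed.

Lemma wtX i k A : wt i A -> wt (i * k) (A ^+ k).
Proof.
move=> hA; elim: k => [|k IH]; first by rewrite muln0; apply: wt1.
by rewrite exprS mulnS; apply: wtM.
Qed.

Lemma wt_gt i A : (forall a, phi a < i)%N -> wt i A -> A = 0.
Proof. by move=> h hA; apply/matrixP => a b; rewrite hA ?mxE // ltn_addl. Qed.

Lemma wt_nilpotent A k : wt 1 A -> (forall a, phi a < k)%N -> A ^+ k = 0.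
Proof. by move=> hA hk; apply: (@wt_gt k) => //; have := wtX (k := k) hA; rewrite mul1n. Qed.

End Weight.

(** * Unipotent matrices: inverses and commutators *)

Section Unipotent.
Variables (K : comUnitRingType) (N : nat) (phi : 'I_N.+1 -> nat).
Local Notation mx := ('M[K]_N.+1).
Local Notation wt := (wt phi).
Implicit Types g h : mx.

(** The geometric series in [1 - g] telescopes, and its remainder [(1 - g) ^+ k] vanishes by
    nilpotency. *)
Lemma unip_mulV g k : wt 1 (g - 1) -> (forall a, phi a < k)%N ->
  g * (\sum_(i < k) (1 - g) ^+ i) = 1.
Proof.
move=> hg hk; have hn : (1 - g) ^+ k = 0.
  by apply: (wt_nilpotent _ hk); rewrite -opprB; apply: wtN.
have := subrX1 (1 - g) k; rewrite hn sub0r addrAC subrr add0r mulNr => /oppr_inj.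
by move=> <-.
Qed.

Lemma unip_bound : exists k, forall a, (phi a < k)%N.
Proof. by exists (\max_a phi a).+1 => a; rewrite ltnS (leq_bigmax a). Qed.

Lemma unip_unit g : wt 1 (g - 1) -> g \is a GRing.unit.
Proof.
move=> hg; have [k hk] := unip_bound.
by have [] := mulmx1_unit (unip_mulV hg hk).
Qed.

Lemma unip_invE g k : wt 1 (g - 1) -> (forall a, phi a < k)%N ->
  g^-1 = \sum_(i < k) (1 - g) ^+ i.
Proof.
move=> hg hk; have := mulKr (unip_unit hg) (\sum_(i < k) (1 - g) ^+ i).
by rewrite (unip_mulV hg hk) mulr1.
Qed.

Lemma unip_wt0 g : wt 1 (g - 1) -> wt 0 g.
Proof.
move=> hg; rewrite -[g](subrK 1); apply: wtD; last exact: wt1.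
exact: wtW hg.
Qed.

Lemma unip_inv_wt0 g : wt 1 (g - 1) -> wt 0 g^-1.
Proof.
move=> hg; have [k hk] := unip_bound; rewrite (unip_invE hg hk).
apply: wt_sum => i _; have h : wt 1 (1 - g) by rewrite -opprB; apply: wtN.
by apply: (@wtW _ _ _ _ (1 * i)) => //; apply: wtX.
Qed.

Lemma unipM i g h : (0 < i)%N -> wt i (g - 1) -> wt i (h - 1) -> wt i (g * h - 1).
Proof.
move=> i0 hg hh; have -> : g * h - 1 = g * (h - 1) + (g - 1).
  by rewrite mulrBr mulr1 addrA subrK.
apply: wtD => //; rewrite -[i]add0n; apply: wtM => //.
by apply: unip_wt0; apply: wtW hg.
Qed.

Lemma unipV i g : (0 < i)%N -> wt i (g - 1) -> wt i (g^-1 - 1).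
Proof.
move=> i0 hg; have h1 : wt 1 (g - 1) by apply: wtW hg.
have -> : g^-1 - 1 = - (g^-1 * (g - 1)).
  by rewrite mulrBr mulr1 mulVr ?unip_unit // opprB.
apply: wtN; rewrite -[i]add0n; apply: wtM => //; exact: unip_inv_wt0.
Qed.

(** The group commutator minus [1] is [g^-1 * h^-1] times the additive commutator of [g - 1] and
    [h - 1]; the latter has weight [i + j] and the inverses have weight [0]. *)
Lemma unip_comm i j g h : (0 < i)%N -> (0 < j)%N ->
  wt i (g - 1) -> wt j (h - 1) -> wt (i + j) (g^-1 * h^-1 * g * h - 1).
Proof.
move=> i0 j0 hg hh.
have g1 : wt 1 (g - 1) by apply: wtW hg.
have h1 : wt 1 (h - 1) by apply: wtW hh.
have -> : g^-1 * h^-1 * g * h - 1 =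
    g^-1 * h^-1 * ((g - 1) * (h - 1) - (h - 1) * (g - 1)).
  have -> : (g - 1) * (h - 1) - (h - 1) * (g - 1) = g * h - h * g.
    rewrite !mulrBl !mulrBr !mul1r !mulr1.
    move: (g * h) (h * g) (1 : mx) => x y z.
    by apply/matrixP => a b; rewrite !mxE; ring.
  rewrite mulrBr !mulrA mulrVK ?unip_unit //.
  by rewrite mulVr ?unip_unit // -!mulrA.
rewrite -[(i + j)%N]add0n; apply: wtM.
  by rewrite -[0%N]addn0; apply: wtM; apply: unip_inv_wt0.
by apply: wtB; [|rewrite addnC]; apply: wtM.
Qed.

End Unipotent.

(** * Binomial coefficients of integers and integer powers of unipotent matrices *)

Section Binomial.

Lemma falling_diff k (n : int) :
  \prod_(i < k.+1) (n + 1 - i%:Z) - \prod_(i < k.+1) (n - i%:Z)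
  = k.+1%:Z * \prod_(i < k) (n - i%:Z).
Proof.
rewrite big_ord_recl [X in _ - X]big_ord_recr /=.
under eq_bigr => i _ do rewrite [bump _ _]/= /bump /= -addn1 addnC PoszD opprD addrACA subrr addr0.
rewrite -addn1 PoszD; ring.
Qed.

Lemma fact_dvd_falling k (n : int) : ((k`!)%:Z %| \prod_(i < k) (n - i%:Z))%Z.
Proof.
elim: k n => [|k IH] n; first by rewrite big_ord0 dvd1z.
have step (m : int) : ((k.+1`!)%:Z %| \prod_(i < k.+1) (m + 1 - i%:Z))%Z =
    ((k.+1`!)%:Z %| \prod_(i < k.+1) (m - i%:Z))%Z.
  rewrite -[X in (_ %| X)%Z](subrK (\prod_(i < k.+1) (m - i%:Z))) falling_diff.
  by rewrite rpredDl // factS PoszM dvdz_mul.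
elim/int_rect: n => [|n|n] /=.
- by rewrite big_ord_recl subrr mul0r dvdz0.
- by rewrite [n.+1%:Z]intS addrC step.
- by move=> h; rewrite -step [n.+1%:Z]intS opprD [- 1 - _]addrC subrK.
Qed.

Lemma binzE n k : binz n k * (k`!)%:Z = \prod_(i < k) (n - i%:Z).
Proof. by rewrite divzK ?fact_dvd_falling. Qed.

Lemma binzn0 n : binz n 0 = 1.
Proof. by rewrite /binz big_ord0 divz1. Qed.

Lemma fact_neq0 k : (k`!)%:Z != 0.
Proof. by rewrite eqz_nat -lt0n fact_gt0. Qed.

Lemma binzS n k : binz (n + 1) k.+1 = binz n k.+1 + binz n k.
Proof.
apply: (mulIf (fact_neq0 k.+1)); rewrite mulrDl !binzE.
rewrite -[LHS](subrK (\prod_(i < k.+1) (n - i%:Z))) falling_diff [LHS]addrC.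
by congr (_ + _); rewrite factS PoszM mulrCA binzE.
Qed.

Lemma binz_nat (n k : nat) : binz n k = 'C(n, k)%:Z.
Proof.
elim: n k => [|n IH] [|k]; rewrite ?binzn0 ?bin0 //.
  apply: (mulIf (fact_neq0 k.+1)); rewrite binzE big_ord_recl subrr mul0r.
  by rewrite bin0n.
by rewrite intS addrC binzS !IH binS PoszD.
Qed.

Variable R : realType.

Definition binp (k : nat) : {poly R} :=
  (k`!%:R)^-1 *: \prod_(i < k) ('X - (i%:R)%:P).

Lemma horner_binp k (n : int) : (binp k).[n%:~R] = (binz n k)%:~R.
Proof.
have fact0 : (k`!%:R : R) != 0 by rewrite pnatr_eq0 -lt0n fact_gt0.
apply: (mulIf fact0); rewrite hornerZ mulrAC mulVf // mul1r horner_prod.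
rewrite -[k`!%:R]/((k`!)%:Z%:~R) -intrM binzE rmorph_prod.
by apply: eq_bigr => i _; rewrite hornerXsubC rmorphB.
Qed.

Lemma size_binp k : (size (binp k) <= k.+1)%N.
Proof.
apply: leq_trans (size_scale_leq _ _) _.
by rewrite -big_enum /= size_prod_XsubC size_enum_ord.
Qed.

(** Pascal's rule and [Y ^+ K.+1 = 0] show that the truncated binomial series [L] satisfies
    [L (m + 1) = (1 + Y) * L m]. As [1 + Y] is invertible, this recursion can be run downwards too,
    which covers negative exponents. *)
Lemma unip_powz N (Y : 'M[R]_N.+1) K (e : int) :
  1 + Y \is a GRing.unit -> Y ^+ K.+1 = 0 ->
  (1 + Y) ^ e = \sum_(k < K.+1) (binz e k)%:~R *: Y ^+ k.
Proof.
move=> u0 nil; set L := fun e : int => \sum_(k < K.+1) (binz e k)%:~R *: Y ^+ k.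
rewrite -[RHS]/(L e).
have L0 : L 0 = 1.
  rewrite /L big_ord_recl binzn0 scale1r expr0 big1 ?addr0 // => i _.
  by rewrite -[0]/(0%:Z) binz_nat bin0n scale0r.
have LS m : L (m + 1) = (1 + Y) * L m.
  rewrite mulrDl mul1r /L big_ord_recl [X in X + _ = _]/= !binzn0.
  under eq_bigr => i _ do rewrite lift0 binzS rmorphD scalerDl.
  rewrite big_split addrA; congr (_ + _).
    by rewrite big_ord_recl binzn0.
  rewrite mulr_sumr big_ord_recr /= -scalerAr -exprS nil scaler0 addr0.
  by apply: eq_bigr => i _; rewrite -scalerAr -exprS.
elim/int_rect: e => [|n IH|n IH]; first by rewrite L0.
  by rewrite intS exprzDr // expr1z IH -LS addrC.
have := LS (- n.+1%:Z); rewrite intS opprD [- 1 - _]addrC subrK -IH => h.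
by rewrite [- _ - 1]addrC exprzDr // h exprN1 mulKr // addrC.
Qed.

End Binomial.

(** * Taylor expansion of polynomial matrices *)

Section Taylor.
Variables (R : realType) (N : nat) (phi : 'I_N.+1 -> nat).
Local Notation mx := ('M[R]_N.+1).
Local Notation pmx := ('M[{poly R}]_N.+1).
Local Notation wt := (wt phi).

Definition evmx n (n0 : int) (A : 'M[{poly R}]_n) : 'M[R]_n :=
  map_mx (horner_eval (n0%:~R : R)) A.

Lemma evmxM (n : int) (A B : pmx) : evmx n (A * B) = evmx n A * evmx n B.
Proof. exact: map_mxM. Qed.

Definition poly_wt (A : pmx) := forall a b,
  ((phi a < phi b)%N -> A a b = 0) /\ (size (A a b) <= (phi a - phi b).+1)%N.

Lemma poly_wtM A B : poly_wt A -> poly_wt B -> poly_wt (A * B).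
Proof.
move=> hA hB a b; rewrite mxE; split=> [h|].
  rewrite big1 // => c _; case: (ltnP (phi a) (phi c)) => h1.
    by rewrite (hA a c).1 // mul0r.
  by rewrite (hB c b).1 ?mulr0 //; lia.
apply: (leq_trans (size_sum _ _ _)); apply/bigmax_leqP => c _.
case: (ltnP (phi a) (phi c)) => h1; first by rewrite (hA a c).1 // mul0r size_poly0.
case: (ltnP (phi c) (phi b)) => h2; first by rewrite (hB c b).1 // mulr0 size_poly0.
apply: (leq_trans (size_polyMleq _ _)).
move: h1 h2 (hA a c).2 (hB c b).2.
by move: (phi a) (phi b) (phi c) (size _) (size _) => x y z t u; lia.
Qed.

Lemma poly_eq0_nat_roots (p : {poly R}) i : (size p <= i)%N ->
  (forall m : nat, (m < i)%N -> p.[m%:R] = 0) -> p = 0.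
Proof.
move=> sz h; apply: (@roots_geq_poly_eq0 _ p [seq m%:R | m <- iota 0 i]).
- by apply/allP => x /mapP [m]; rewrite mem_iota => /andP [_ hm] ->; rewrite /root h.
- by rewrite map_inj_uniq ?iota_uniq // => x y /eqP; rewrite eqr_nat => /eqP.
- by rewrite size_map size_iota.
Qed.

(** An entry of weight below [i] has degree below [i] and agrees with the identity at the [i] points
    [0, ..., i - 1], so it is constant. This is what puts the Taylor coefficients into the right
    filtration subgroups. *)
Lemma evmx_sub1_wt i A : poly_wt A -> (0 < i)%N ->
  (forall m : nat, (m < i)%N -> evmx m A = 1) -> forall n, wt i (evmx n A - 1).
Proof.
move=> hA i0 h n a b hab; rewrite !mxE.
have sz1 (x : bool) : (size (x%:R : {poly R}) <= 1)%N.
  by case: x; rewrite ?size_poly1 ?size_poly0.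
have ev1 (x : bool) (z : R) : (x%:R : {poly R}).[z] = x%:R by case: x; rewrite hornerE.
suff -> : A a b = (a == b)%:R.
  by rewrite /horner_eval ev1 subrr.
apply/eqP; rewrite -subr_eq0; apply/eqP; apply: (@poly_eq0_nat_roots _ i).
  apply: (leq_trans (size_polyD _ _)); rewrite size_polyN geq_max.
  by rewrite (leq_trans (hA a b).2) ?(leq_trans (sz1 _)) //; lia.
move=> m hm; have /matrixP/(_ a b) := h m hm; rewrite !mxE /horner_eval /= => E.
by rewrite hornerD hornerN ev1 E subrr.
Qed.

(** In the binomial series, [Y ^+ k] has weight at least [i * k], while its coefficient is the
    binomial polynomial of index [k] evaluated at [- binp R i], of degree at most [k * i]. Hence
    degrees never exceed weights. *)
Lemma unip_powz_poly i (Y : mx) : wt 1 Y -> wt i Y ->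
  exists L : pmx, poly_wt L /\ forall n : int, evmx n L = (1 + Y) ^ (- binz n i).
Proof.
move=> h1 hi; have [K hK] := unip_bound phi.
have nil : Y ^+ K.+1 = 0 by apply: (wt_nilpotent h1) => a; apply: leqW.
have u : 1 + Y \is a GRing.unit.
  by apply: (@unip_unit _ _ phi); rewrite addrAC subrr add0r.
exists (\sum_(k < K.+1) (binp R k \Po (- binp R i)) *: map_mx polyC (Y ^+ k)); split.
  move=> a b; rewrite summxE; have hY k : ((phi a < phi b + i * k)%N -> (Y ^+ k) a b = 0).
    by move=> h; apply: (wtX (k := k) hi).
  split=> [h|].
    rewrite big1 // => k _; rewrite !mxE hY ?mulr0 //.
    by lia.
  apply: (leq_trans (size_sum _ _ _)); apply/bigmax_leqP => k _; rewrite !mxE.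
  case: (ltnP (phi a) (phi b + i * k)) => h; first by rewrite hY // mulr0 size_poly0.
  rewrite mulrC mul_polyC; apply: (leq_trans (size_scale_leq _ _)).
  apply: (leq_trans (size_comp_poly_leq _ _)); rewrite size_polyN ltnS.
  apply: (@leq_trans (k * i)); last by rewrite mulnC leq_subRL ?(leq_trans _ h) ?leq_addr.
  by apply: leq_mul; rewrite -subn1 leq_subLR add1n size_binp.
move=> n; rewrite (unip_powz _ u nil) /evmx raddf_sum; apply: eq_bigr => k _ /=.
apply/matrixP => a b; rewrite !mxE /horner_eval /= hornerM hornerC horner_comp hornerN.
by rewrite horner_binp -rmorphN horner_binp.
Qed.

(** Factors are peeled off from the left. If the remainder [H] is trivial at [0, ..., i - 1], take
    [g i] to be its value at [i] and multiply [H] by the inverse power [g i ^ (- binz n i)]. The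
    value at [i] becomes [1], and earlier values are unaffected because [binz m i = 0] for [m < i].
    The maximum with [1] reflects the convention that the groups of index [0] and [1] coincide. *)
Lemma taylor (A : pmx) : poly_wt A -> (forall n, wt 1 (evmx n A - 1)) ->
  forall i, exists (g : nat -> mx) (H : pmx),
  [/\ forall j, (j < i)%N -> wt (maxn j 1) (g j - 1),
      poly_wt H, forall n, wt 1 (evmx n H - 1),
      forall n, evmx n A = \prod_(j < i) g j ^ (binz n j) * evmx n H
    & forall m : nat, (m < i)%N -> evmx m H = 1].
Proof.
move=> pA uA; elim=> [|i [g [H [hg pH uH eA rH]]]].
  by exists (fun _ => 1), A; split=> // n; rewrite big_ord0 mul1r.
pose gi := evmx i H.
have hgi : wt (maxn i 1) (gi - 1).
  case: (posnP i) => [->|i0]; first by rewrite max0n; apply: uH.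
  by rewrite (maxn_idPl i0); apply: evmx_sub1_wt.
have ugi : gi \is a GRing.unit.
  by apply: (@unip_unit _ _ phi); apply: wtW hgi; lia.
have h1 : wt 1 (gi - 1) by apply: wtW hgi; lia.
have [||L [pL eL]] := @unip_powz_poly i (gi - 1).
- by apply: wtW hgi; lia.
- by apply: wtW hgi; lia.
have {}eL n : evmx n L = gi ^ (- binz n i) by rewrite eL [1 + _]addrC subrK.
have uL n : wt 1 (evmx n L - 1).
  have uX m : wt 1 (gi ^+ m - 1).
    elim: m => [|m IH]; first by rewrite expr0 subrr; apply: wt0.
    by rewrite exprS; apply: unipM.
  rewrite eL; case: (- _) => m; first exact: uX.
  by rewrite NegzE -exprz_inv -exprnP exprVn; apply: unipV.
exists (fun j => if (j < i)%N then g j else gi), (L * H); split.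
- move=> j; rewrite ltnS leq_eqVlt => /orP [/eqP ->|h]; first by rewrite ltnn.
  by rewrite h; apply: hg.
- exact: poly_wtM.
- by move=> n; rewrite evmxM; apply: unipM.
- move=> n; rewrite eA big_ord_recr /= ltnn -mulrA; congr (_ * _).
    by apply: eq_bigr => j _; rewrite ltn_ord.
  by rewrite evmxM eL mulrA -exprzDr // subrr expr0z mul1r.
- move=> m; rewrite ltnS leq_eqVlt evmxM eL binz_nat => /orP [/eqP ->|h].
    by rewrite binn -/gi exprN1 mulVr.
  by rewrite bin_small // oppr0 expr0z mul1r rH.
Qed.

Lemma poly_seq_of_poly_wt (A : pmx) s : poly_wt A ->
  (forall n, wt 1 (evmx n A - 1)) -> (forall a, phi a <= s)%N ->
  poly_seq s (fun i g => wt (maxn i 1) (g - 1)) (fun n => evmx n A).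
Proof.
move=> pA uA hs; have [g [H [hg pH uH eA rH]]] := taylor pA uA s.+1.
exists g; split=> [i hi|n]; first exact: hg.
suff E : evmx n H - 1 = 0 by rewrite eA (subr0_eq E) mulr1.
(* After [s + 1] factors the remainder minus [1] has weight above [s], which no nonzero entry can
   have. *)
by apply: (@wt_gt _ _ phi s.+1) => //; apply: evmx_sub1_wt.
Qed.

End Taylor.

(** * Reduced and integral matrices, and orbits of polynomial matrices *)

Section Factorization.
Variable R : realType.

Definition utri (K : pzRingType) n (A : 'M[K]_n) :=
  (forall a b : 'I_n, (b < a)%N -> A a b = 0) /\ (forall a, A a a = 1).

Definition reduced n (k : 'M[R]_n) :=
  utri k /\ forall a b : 'I_n, (a < b)%N -> 0 <= k a b < 1.

Definition integral n (m : 'M[R]_n) :=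
  utri m /\ forall a b, m a b \is a Num.int.

Lemma mxtens_index_lt n1 n2 (i k : 'I_n1) (j l : 'I_n2) :
  (mxtens.mxtens_index (i, j) < mxtens.mxtens_index (k, l))%N ->
  (i < k)%N \/ i = k /\ (j < l)%N.
Proof.
rewrite /=; case: (ltngtP i k) => [h|h|/val_inj ->] hlt; [by left| |].
  have := ltn_ord l; have := leq_mul2r n2 k.+1 i; rewrite h orbT mulSn; lia.
by right; split=> //; lia.
Qed.

Lemma utri_tens (K : pzRingType) n1 n2 (A : 'M[K]_n1) (B : 'M[K]_n2) :
  utri A -> utri B -> utri (mxtens.tensmx A B).
Proof.
move=> [A0 A1] [B0 B1]; split=> [a b|a].
  case: (mxtens.mxtens_indexP a) => i j; case: (mxtens.mxtens_indexP b) => k l.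
  rewrite mxtens.tensmxE => /mxtens_index_lt [h|[-> h]]; first by rewrite A0 // mul0r.
  by rewrite B0 // mulr0.
case: (mxtens.mxtens_indexP a) => i j; by rewrite mxtens.tensmxE A1 B1 mulr1.
Qed.

Lemma reduced_itv01 n (k : 'M[R]_n) a b : reduced k -> 0 <= k a b <= 1.
Proof.
move=> [[k0 k1] kr]; case: (ltngtP a b) => h.
- by have /andP [-> /ltW ->] := kr a b h.
- by rewrite k0 // lexx ler01.
- by rewrite (val_inj h) k1 lexx ler01.
Qed.

(** Pairs of indices are ordered lexicographically, so above the diagonal at least one of the two
    factors of an entry lies above its own diagonal, hence in [[0,1)]; the other lies in [[0,1]]. *)
Lemma reduced_tens n1 n2 (A : 'M[R]_n1) (B : 'M[R]_n2) :
  reduced A -> reduced B -> reduced (mxtens.tensmx A B).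
Proof.
move=> rA rB; split; first by apply: utri_tens; [case: rA|case: rB].
move=> a b; case: (mxtens.mxtens_indexP a) => i j; case: (mxtens.mxtens_indexP b) => k l.
have /andP [x0 x1] := reduced_itv01 i k rA.
have /andP [y0 y1] := reduced_itv01 j l rB.
rewrite mxtens.tensmxE mulr_ge0 //= => /mxtens_index_lt [h|[_ h]].
  have /andP [_ lt1] := rA.2 i k h.
  by apply: le_lt_trans lt1; rewrite ler_piMr.
have /andP [_ lt1] := rB.2 j l h.
by apply: le_lt_trans lt1; rewrite ler_piMl.
Qed.

Lemma integral_tens n1 n2 (A : 'M[R]_n1) (B : 'M[R]_n2) :
  integral A -> integral B -> integral (mxtens.tensmx A B).
Proof.
move=> [uA iA] [uB iB]; split; first exact: utri_tens.
by move=> a b; rewrite mxE rpredM.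
Qed.

Lemma utri_border (K : pzRingType) n (r : 'rV[K]_n) (A : 'M[K]_n) :
  utri A -> utri (block_mx 1%:M r 0 A : 'M_(1 + n)).
Proof.
move=> [A0 A1]; split=> [a b|a]; case: (split_ordP a) => a' ->; last first.
- by rewrite block_mxEdr A1.
- by rewrite block_mxEul mxE eqxx.
- case: (split_ordP b) => b' ->; rewrite ?block_mxEdl ?block_mxEdr ?mxE //= => h.
  by apply: A0; lia.
- by case: (split_ordP b) => b' ->; rewrite /= ?(ord1 a') ?(ord1 b') //; lia.
Qed.

Lemma reduced_border n (r : 'rV[R]_n) (A : 'M[R]_n) : (forall b, 0 <= r 0 b < 1) ->
  reduced A -> reduced (block_mx 1%:M r 0 A : 'M_(1 + n)).
Proof.
move=> hr [uA rA]; split=> [|a b]; first exact: utri_border.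
case: (split_ordP a) => a' ->; case: (split_ordP b) => b' -> //=; rewrite ?(ord1 a') ?(ord1 b') //.
- by rewrite block_mxEur.
- by rewrite block_mxEdr => h; apply: rA; lia.
Qed.

Lemma integral_border n (r : 'rV[R]_n) (A : 'M[R]_n) : (forall b, r 0 b \is a Num.int) ->
  integral A -> integral (block_mx 1%:M r 0 A : 'M_(1 + n)).
Proof.
move=> hr [uA iA]; split=> [|a b]; first exact: utri_border.
case: (split_ordP a) => a' ->; case: (split_ordP b) => b' ->.
- by rewrite block_mxEul mxE.
- by rewrite block_mxEur (ord1 a').
- by rewrite block_mxEdl mxE.
- by rewrite block_mxEdr.
Qed.

Variable T : Type.

(** The parameter [t : T] will be the polynomial [p] of the theorem; the bound is uniform in it, so
    one group serves every [p]. *)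
Definition bounded_degree (P : T -> {poly R}) := exists D, forall t, (size (P t) <= D)%N.

Lemma bounded_degreeM P Q : bounded_degree P -> bounded_degree Q ->
  bounded_degree (fun t => P t * Q t).
Proof.
move=> [D hP] [E hQ]; exists (D + E)%N => t; apply: leq_trans (size_polyMleq _ _) _.
by have := hP t; have := hQ t; lia.
Qed.

Lemma bounded_degree_cst q : bounded_degree (fun _ => q).
Proof. by exists (size q). Qed.

(* [k t x] is the fractional part, i.e. the representative in the fundamental
   domain, of the point of the nilmanifold given by a polynomial sequence. *)
Definition nil_orbit n (k : T -> int -> 'M[R]_n) :=
  exists G : T -> 'M[{poly R}]_n,
  [/\ forall a b, bounded_degree (fun t => G t a b),
      forall t, utri (G t)
    & forall t x, reduced (k t x) /\
        exists m, integral m /\ evmx x (G t) = k t x *m m].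

Lemma nil_orbit1 : nil_orbit (fun _ _ => (1%:M : 'M[R]_1)).
Proof.
have u1 (K : pzRingType) : utri (1%:M : 'M[K]_1).
  by split=> a; rewrite ?(ord1 a) ?mxE //= => b; rewrite ltn0.
exists (fun _ => 1%:M); split=> // [a b|t x]; first exact: bounded_degree_cst.
split; first by split=> // a b; rewrite (ord1 a) (ord1 b).
exists 1%:M; split; last by rewrite /evmx map_mx1 mulmx1.
by split=> // a b; rewrite mxE.
Qed.

Lemma nil_orbit_tens n1 n2 (k1 : T -> int -> 'M[R]_n1) (k2 : T -> int -> 'M[R]_n2) :
  nil_orbit k1 -> nil_orbit k2 ->
  nil_orbit (fun t x => mxtens.tensmx (k1 t x) (k2 t x)).
Proof.
move=> [G1 [d1 u1 e1]] [G2 [d2 u2 e2]].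
exists (fun t => mxtens.tensmx (G1 t) (G2 t)); split=> [a b|t|t x].
- case: (mxtens.mxtens_indexP a) => i j; case: (mxtens.mxtens_indexP b) => k l.
  have [D hD] := bounded_degreeM (d1 i k) (d2 j l).
  by exists D => t; rewrite mxtens.tensmxE.
- exact: utri_tens.
- have [r1 [m1 [i1 E1]]] := e1 t x; have [r2 [m2 [i2 E2]]] := e2 t x.
  split; first exact: reduced_tens.
  exists (mxtens.tensmx m1 m2); split; first exact: integral_tens.
  by rewrite /evmx mxtens.map_mxT mxtens.tensmx_mul -E1 -E2.
Qed.

Definition fpart (x : R) := x - (Num.floor x)%:~R.

Lemma fpart_itv x : 0 <= fpart x < 1.
Proof. by rewrite /fpart subr_ge0 floor_le ltrBlDl -[1]/(1%:~R) -intrD floorD1_gt. Qed.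

(* Prepending the row [P t * (row i)] to the orbit adds [P t * k i j mod 1] to its
   entries: with [k' = (1, {P k_i}; 0, k)] and [m' = (1, floor(P k_i) m; 0, m)], the
   first row of [k' m'] is [(1, P k_i m)]. *)
Lemma nil_orbit_border n (k : T -> int -> 'M[R]_n) P i :
  nil_orbit k -> bounded_degree P ->
  nil_orbit (fun t x => block_mx 1%:M (\row_j fpart ((P t).[x%:~R] * k t x i j)) 0 (k t x)
    : 'M[R]_(1 + n)).
Proof.
move=> [G [dG uG eG]] dP.
exists (fun t => block_mx 1%:M (P t *: row i (G t)) 0 (G t)); split=> [a b|t|t x].
- case: (split_ordP a) => a' ->; case: (split_ordP b) => b' ->.
  + by exists (size ((1%:M : 'M[{poly R}]_1) a' b')) => t; rewrite block_mxEul.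
  + have [D hD] := bounded_degreeM dP (dG i b').
    by exists D => t; rewrite block_mxEur !mxE.
  + by exists 0%N => t; rewrite block_mxEdl mxE size_poly0.
  + by have [D hD] := dG a' b'; exists D => t; rewrite block_mxEdr.
- exact: utri_border.
- have [r [m [im E]]] := eG t x; split.
    by apply: reduced_border => // b; rewrite mxE fpart_itv.
  set z : 'rV[R]_n := \row_j (Num.floor ((P t).[x%:~R] * k t x i j))%:~R.
  exists (block_mx 1%:M (z *m m) 0 m); split.
    apply: integral_border => // b; rewrite mxE; rewrite rpred_sum // => c _.
    by rewrite rpredM ?im.2 // mxE intr_int.
  rewrite mulmx_block !mulmx0 !mul0mx !mul1mx !addr0 add0r -E.
  rewrite /evmx map_block_mx map_mx1 map_mx0 /=; congr block_mx.
  rewrite -mulmxDl map_mxZ /= map_row /=.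
  rewrite -/(evmx x (G t)) E row_mul scalemxAl; congr (_ *m _).
  by apply/rowP => j; rewrite !mxE addrC subrK.
Qed.

End Factorization.

(** * Calculus of generalised polynomials over nil orbits *)

Section Calculus.
Variables (R : realType) (T : Type).
Local Notation fn := (T -> int -> R).

(** A syntactic closure makes stability under sums and products immediate; the semialgebraic
    partition is recovered in [pattern_poly_piecewise]. *)
Inductive piecewise (n : nat) : ('M[R]_n -> R) -> Prop :=
  | pw_cst c : piecewise (fun _ => c)
  | pw_entry i j : piecewise (fun A => A i j)
  | pw_add (u v : 'M[R]_n -> R) : piecewise u -> piecewise v -> piecewise (fun A => u A + v A)
  | pw_mul (u v : 'M[R]_n -> R) : piecewise u -> piecewise v -> piecewise (fun A => u A * v A)
  | pw_step (u : 'M[R]_n -> R) : piecewise u -> piecewise (fun A => (0 <= u A)%R%:R).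

Lemma piecewise_mxsub n n' (f : 'I_n -> 'I_n') (u : 'M[R]_n -> R) :
  piecewise u -> piecewise (fun A => u (mxsub f f A)).
Proof.
elim=> {u} [c|i j|u v _ hu _ hv|u v _ hu _ hv|u _ hu].
- exact: pw_cst.
- have -> : (fun A => mxsub f f A i j) = (fun A : 'M[R]_n' => A (f i) (f j)).
    by apply: funext => A; rewrite mxE.
  exact: pw_entry.
- exact: pw_add hu hv.
- exact: pw_mul hu hv.
- exact: pw_step hu.
Qed.

(** Positivity of [n] supplies the base index for embedding one orbit in a Kronecker product, as
    well as the size [N.+1] of the final matrices. *)
Definition nil_fun (a : fn) := exists n (k : T -> int -> 'M[R]_n) (u : 'M[R]_n -> R),
  [/\ (0 < n)%N, nil_orbit k, piecewise u & forall t x, a t x = u (k t x)].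

Definition nil_entry (a : fn) := exists n (k : T -> int -> 'M[R]_n) i j,
  nil_orbit k /\ forall t x, a t x = k t x i j.

Lemma nil_entry_fun a : nil_entry a -> nil_fun a.
Proof.
move=> [n [k [i [j [hk E]]]]]; exists n, k, (fun A => A i j); split=> //.
  by case: n i {j k hk E} => // [[]].
exact: pw_entry.
Qed.

Lemma nil_entry_cst1 : nil_entry (fun _ _ => 1).
Proof.
exists 1%N, (fun _ _ => 1%:M), 0, 0; split; first exact: nil_orbit1.
by move=> t x; rewrite mxE.
Qed.

Lemma nil_entry_itv a t x : nil_entry a -> 0 <= a t x <= 1.
Proof.
move=> [n [k [i [j [[G [_ _ h]] ->]]]]].
by apply: reduced_itv01; have [] := h t x.
Qed.

Lemma nil_entryM a b : nil_entry a -> nil_entry b -> nil_entry (fun t x => a t x * b t x).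
Proof.
move=> [n1 [k1 [i1 [j1 [h1 E1]]]]] [n2 [k2 [i2 [j2 [h2 E2]]]]].
exists (n1 * n2)%N, (fun t x => mxtens.tensmx (k1 t x) (k2 t x)).
exists (mxtens.mxtens_index (i1, i2)), (mxtens.mxtens_index (j1, j2)).
split; first exact: nil_orbit_tens h1 h2.
by move=> t x; rewrite mxtens.tensmxE E1 E2.
Qed.

Lemma nil_entry_fpart a P : nil_entry a -> bounded_degree P ->
  nil_entry (fun t x => fpart ((P t).[x%:~R] * a t x)).
Proof.
move=> [n [k [i [j [hk E]]]]] dP.
have h := nil_orbit_border i hk dP.
exists (1 + n)%N; eexists; exists (lshift n 0), (rshift 1 j); split; first exact: h.
by move=> t x; rewrite block_mxEur mxE E.
Qed.

Lemma nil_fun_cst c : nil_fun (fun _ _ => c).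
Proof.
exists 1%N, (fun _ _ => 1%:M), (fun _ => c).
by split=> //; [exact: nil_orbit1 | exact: pw_cst].
Qed.

(** Both orbits can be read off a single one: fixing a diagonal position of one Kronecker factor,
    where the entry is [1], leaves the other factor as a submatrix. *)
Lemma nil_fun2 (op : R -> R -> R) a b :
  (forall n (u v : 'M[R]_n -> R), piecewise u -> piecewise v ->
     piecewise (fun A => op (u A) (v A))) ->
  nil_fun a -> nil_fun b -> nil_fun (fun t x => op (a t x) (b t x)).
Proof.
move=> hop [n1 [k1 [u1 [p1 h1 w1 E1]]]] [n2 [k2 [u2 [p2 h2 w2 E2]]]].
pose f1 (i : 'I_n1) := mxtens.mxtens_index (i, Ordinal p2).
pose f2 (j : 'I_n2) := mxtens.mxtens_index (Ordinal p1, j).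
exists (n1 * n2)%N, (fun t x => mxtens.tensmx (k1 t x) (k2 t x)).
exists (fun A => op (u1 (mxsub f1 f1 A)) (u2 (mxsub f2 f2 A))); split.
- by rewrite muln_gt0 p1.
- exact: nil_orbit_tens.
- by apply: hop; apply: piecewise_mxsub.
- move=> t x; have [G1 [_ _ r1]] := h1; have [G2 [_ _ r2]] := h2.
  have [[[_ d1] _] _] := r1 t x; have [[[_ d2] _] _] := r2 t x.
  rewrite E1 E2; congr (op (u1 _) (u2 _)); apply/matrixP => i j.
    by rewrite [RHS]mxE mxtens.tensmxE d2 mulr1.
  by rewrite [RHS]mxE mxtens.tensmxE d1 mul1r.
Qed.

Lemma nil_funD a b : nil_fun a -> nil_fun b -> nil_fun (fun t x => a t x + b t x).
Proof. by apply: nil_fun2 => n; apply: pw_add. Qed.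

Lemma nil_funM a b : nil_fun a -> nil_fun b -> nil_fun (fun t x => a t x * b t x).
Proof. by apply: nil_fun2 => n; apply: pw_mul. Qed.

Lemma nil_fun_step a : nil_fun a -> nil_fun (fun t x => (0 <= a t x)%R%:R).
Proof.
move=> [n [k [u [p h w E]]]]; exists n, k, (fun A => (0 <= u A)%R%:R); split=> //.
  exact: pw_step.
by move=> t x; rewrite E.
Qed.

Lemma nil_fun_ext a b : nil_fun a -> (forall t x, a t x = b t x) -> nil_fun b.
Proof. by move=> h e; have -> : b = a by do 2!apply: funext => ?; rewrite e. Qed.

(** [P] is kept apart because it is unbounded. [kap] is a single entry so that [nil_entry_fpart]
    applies to [P * kap], and [chi] is 0/1-valued so that multiplying by it preserves congruence
    modulo 1. *)
Inductive genpoly : fn -> Prop :=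
  | gp_term (chi : fn) P kap : nil_fun chi -> (forall t x, exists b : bool, chi t x = b%:R) ->
      bounded_degree P -> nil_entry kap ->
      genpoly (fun t x => chi t x * (P t).[x%:~R] * kap t x)
  | gp_add u v : genpoly u -> genpoly v -> genpoly (fun t x => u t x + v t x).

Lemma genpoly_ext u v : genpoly u -> (forall t x, u t x = v t x) -> genpoly v.
Proof. by move=> h e; have -> : v = u by do 2!apply: funext => ?; rewrite e. Qed.

Lemma genpoly_poly P : bounded_degree P -> genpoly (fun t x => (P t).[x%:~R]).
Proof.
move=> dP; apply: (@genpoly_ext (fun t x => 1 * (P t).[x%:~R] * 1)).
  apply: gp_term => //; [exact: nil_fun_cst | by exists true | exact: nil_entry_cst1].
by move=> t x; rewrite mul1r mulr1.
Qed.

Lemma genpoly_cst c : genpoly (fun _ _ => c).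
Proof.
apply: (genpoly_ext (genpoly_poly (bounded_degree_cst _ c%:P))) => t x.
by rewrite hornerC.
Qed.

Lemma genpoly_bool chi : nil_fun chi -> (forall t x, exists b : bool, chi t x = b%:R) ->
  genpoly chi.
Proof.
move=> h hb; apply: (@genpoly_ext (fun t x => chi t x * (1%:P).[x%:~R] * 1)).
  by apply: gp_term => //; [exact: bounded_degree_cst | exact: nil_entry_cst1].
by move=> t x; rewrite hornerC !mulr1.
Qed.

Lemma genpolyM u v : genpoly u -> genpoly v -> genpoly (fun t x => u t x * v t x).
Proof.
move=> hu hv; elim: hu => {u} [c1 P1 k1 n1 b1 d1 e1|u1 u2 _ h1 _ h2]; last first.
  by apply: genpoly_ext (gp_add h1 h2) _ => t x; rewrite mulrDl.
elim: hv => {v} [c2 P2 k2 n2 b2 d2 e2|v1 v2 _ h1 _ h2]; last first.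
  by apply: genpoly_ext (gp_add h1 h2) _ => t x; rewrite mulrDr.
apply: genpoly_ext (gp_term (nil_funM n1 n2) _ (bounded_degreeM d1 d2) (nil_entryM e1 e2)) _.
  move=> t x; have [x1 ->] := b1 t x; have [x2 ->] := b2 t x.
  by exists (x1 && x2); rewrite -mulnb natrM.
by move=> t x; rewrite hornerM; ring.
Qed.

Lemma genpolyB u v : genpoly u -> genpoly v -> genpoly (fun t x => u t x - v t x).
Proof.
move=> hu hv; apply: genpoly_ext (gp_add hu (genpolyM (genpoly_cst (-1)) hv)) _.
by move=> t x; rewrite mulN1r.
Qed.

(* Modulo 1 only the fractional parts of the coefficients [P * kap] matter, and
   these are again matrix entries of a nilpotent orbit. *)
Lemma genpoly_mod1 u : genpoly u -> exists (v : fn) (L : nat),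
  [/\ nil_fun v, genpoly v, forall t x, 0 <= v t x <= L%:R
    & forall t x, u t x - v t x \is a Num.int].
Proof.
elim=> {u} [c P k n b d e|u1 u2 _ [v1 [L1 [n1 g1 b1 i1]]] _ [v2 [L2 [n2 g2 b2 i2]]]].
  have ef := nil_entry_fpart e d.
  exists (fun t x => c t x * fpart ((P t).[x%:~R] * k t x)), 1%N; split.
  - exact/nil_funM/nil_entry_fun.
  - apply: genpoly_ext (gp_term n b (bounded_degree_cst _ 1%:P) ef) _ => t x.
    by rewrite hornerC mulr1.
  - move=> t x; have [[] ->] := b t x; rewrite ?mul1r ?mul0r ?lexx ?ler01 //.
    exact: (nil_entry_itv t x ef).
  - move=> t x; rewrite -mulrA -mulrBr /fpart opprB addrC subrK.
    by have [[] ->] := b t x; rewrite ?mul1r ?mul0r ?intr_int.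
exists (fun t x => v1 t x + v2 t x), (L1 + L2)%N; split.
- exact: nil_funD.
- exact: gp_add.
- by move=> t x; have := b1 t x; have := b2 t x; rewrite natrD; lra.
- by move=> t x; rewrite opprD addrACA rpredD.
Qed.

(** The integer part counts those of [1, ..., L] that do not exceed [y], so on a bounded range it is
    a finite sum of step functions. *)
Lemma floor_steps (y : R) L : 0 <= y <= L%:R ->
  (Num.floor y)%:~R = \sum_(j < L) (0 <= y - j.+1%:R)%R%:R :> R.
Proof.
elim: L => [|L IH] /andP [y0 yL].
  by rewrite big_ord0 (@floor_def _ _ 0) // y0 /=; lra.
rewrite big_ord_recr /=; case: (lerP L.+1%:R y) => h.
  have -> : y = L.+1%:R by apply/eqP; rewrite eq_le yL h.
  rewrite subrr lexx -[L.+1%:R]/(L.+1%:Z%:~R) intrKfloor.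
  rewrite (eq_bigr (fun _ => 1)) ?sumr_const ?card_ord => [|j _].
    by rewrite natr1.
  by rewrite subr_ge0 ler_nat ltnS ltnW.
rewrite subr_ge0 leNgt h addr0; case: (lerP y L%:R) => h'.
  by apply: IH; rewrite y0.
rewrite (@floor_def _ _ L%:Z); last by rewrite ltW //= intrD -[_%:~R]/(L%:R) natr1.
rewrite (eq_bigr (fun _ => 1)) ?sumr_const ?card_ord // => j _.
by rewrite subr_ge0 (le_trans _ (ltW h')) // ler_nat.
Qed.

Lemma nil_fun_sum L (a : 'I_L -> fn) :
  (forall j, nil_fun (a j)) -> nil_fun (fun t x => \sum_(j < L) a j t x).
Proof.
elim: L a => [|L IH] a h.
  by apply: nil_fun_ext (nil_fun_cst 0) _ => t x; rewrite big_ord0.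
apply: nil_fun_ext (nil_funD (h ord0) (IH _ (fun j => h (lift ord0 j)))) _ => t x.
by rewrite big_ord_recl.
Qed.

Lemma genpoly_sum L (a : 'I_L -> fn) :
  (forall j, genpoly (a j)) -> genpoly (fun t x => \sum_(j < L) a j t x).
Proof.
elim: L a => [|L IH] a h.
  by apply: genpoly_ext (genpoly_cst 0) _ => t x; rewrite big_ord0.
apply: genpoly_ext (gp_add (h ord0) (IH _ (fun j => h (lift ord0 j)))) _ => t x.
by rewrite big_ord_recl.
Qed.

Lemma nil_fun_geq v c : nil_fun v -> nil_fun (fun t x => (0 <= v t x - c)%R%:R).
Proof. by move=> h; apply: nil_fun_step; apply: nil_funD (nil_fun_cst _). Qed.

Lemma floor_mod1 (u v : R) : u - v \is a Num.int ->
  (Num.floor u)%:~R = u - v + (Num.floor v)%:~R :> R.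
Proof.
move=> h; rewrite -[in LHS](subrK v u) floorDzr // intrD; congr (_ + _).
by rewrite floorK.
Qed.

(** With [v] bounded and congruent to [u] modulo 1, the integer part of [u] is [u - v] plus that of
    [v], and the latter is a sum of steps. *)
Lemma genpoly_floor u : genpoly u -> genpoly (fun t x => (Num.floor (u t x))%:~R).
Proof.
move=> gu; have [v [L [nv gv bv iv]]] := genpoly_mod1 gu.
apply: genpoly_ext (gp_add (genpolyB gu gv) (@genpoly_sum L
  (fun j t x => (0 <= v t x - j.+1%:R)%R%:R) _)) _ => [j|t x].
  by apply: genpoly_bool => [|t x]; [exact: nil_fun_geq | exists (0 <= v t x - j.+1%:R)].
by rewrite (floor_mod1 (iv t x)) -(floor_steps (bv t x)).
Qed.

(** A function with values in [[0,1)] is determined by its class modulo 1, and [genpoly_mod1]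
    represents that class by a [nil_fun]; an affine rescaling reduces to this case. *)
Lemma genpoly_bounded u M : genpoly u -> (forall t x, `|u t x| <= M) -> nil_fun u.
Proof.
(* The summand [1] makes [w < 1] strict and keeps [C] positive. *)
move=> gu hM; set C := 2 * `|M| + 1.
have C0 : 0 < C by rewrite /C; have := normr_ge0 M; lra.
pose w t x := C^-1 * (u t x + `|M|).
have gw : genpoly w by apply: genpolyM (genpoly_cst _) (gp_add gu (genpoly_cst _)).
have [v [L [nv _ bv iv]]] := genpoly_mod1 gw.
have w01 t x : 0 <= w t x < 1.
  have := hM t x; have := ler_norm M; have := ler_norm (u t x); have := ler_norm (- u t x).
  rewrite normrN => h1 h2 h3 h4; rewrite /w mulrC ler_pdivlMr // ltr_pdivrMr //.
  by rewrite /C; lra.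
have fl t x : Num.floor (w t x) = 0 by apply: floor_def; rewrite add0r.
apply: nil_fun_ext (nil_funD (nil_funM (nil_fun_cst C) (nil_funD nv (nil_funM (nil_fun_cst (-1))
  (@nil_fun_sum L (fun j t x => (0 <= v t x - j.+1%:R)%R%:R) _)))) (nil_fun_cst (- `|M|))) _.
  by move=> j; apply: nil_fun_geq.
(* Since [w] has integer part [0], it equals [v] minus the integer part of [v]. *)
move=> t x; rewrite -(floor_steps (bv t x)).
have := floor_mod1 (iv t x); rewrite fl => E.
have -> : v t x + -1 * (Num.floor (v t x))%:~R = w t x.
  by move: E; rewrite mulr0z; lra.
by rewrite /w mulVKf ?gt_eqF // addrK.
Qed.

Lemma genpoly_horner q w : genpoly w -> genpoly (fun t x => q.[w t x]).
Proof.
move=> gw; elim/poly_ind: q => [|q c IH].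
  by apply: genpoly_ext (genpoly_cst 0) _ => t x; rewrite horner0.
apply: genpoly_ext (gp_add (genpolyM IH gw) (genpoly_cst c)) _ => t x.
by rewrite hornerMXaddC.
Qed.

Lemma genpoly_comp u w : is_gen_poly_fun u -> genpoly w -> genpoly (fun t x => u (w t x)).
Proof.
move=> hu gw; elim: hu => {u} [q|u v _ hu _ hv|u v _ hu _ hv|u _ hu].
- exact: genpoly_horner.
- exact: gp_add.
- exact: genpolyM.
- exact: genpoly_floor.
Qed.

End Calculus.

(** The polynomials of degree at most [d] themselves serve as the parameter type, and [val] is then
    a family of bounded degree. *)
Lemma gen_poly_nil_fun (R : realType) (f : int -> R) d : gen_poly_map f -> bounded_map f ->
  nil_fun (fun (p : {p : {poly R} | (size p <= d.+1)%N}) (n : int) =>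
    f (Num.floor (val p).[n%:~R])).
Proof.
move=> [u [hu fu]] [M hM]; apply: (@genpoly_bounded _ _ _ M) => [|t x]; last exact: hM.
have gw := @genpoly_poly R {p : {poly R} | (size p <= d.+1)%N} val _.
apply: genpoly_ext (genpoly_comp hu (genpoly_floor (gw _))) _ => [|t x].
  by exists d.+1 => t; apply: (valP t).
by rewrite fu.
Qed.

(** * The exponential maps onto the unitriangular matrices *)

Section Exponential.
Variables (R : realType) (N : nat).
Local Notation mx := ('M[R]_N.+1).
Local Notation dwt := (wt (fun a : 'I_N.+1 => N - a)%N).

Lemma dwt1P (A : mx) : dwt 1 A <-> strictly_upper A.
Proof.
split=> h a b hab; apply: h; last by move: hab (ltn_ord a) (ltn_ord b); lia.
by move: hab (ltn_ord a) (ltn_ord b) => /=; lia.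
Qed.

Lemma mexp_unip (A : mx) : dwt 1 A -> dwt 1 (mexp A - 1).
Proof.
move=> hA; rewrite /mexp big_ord_recl fact0 invr1 scale1r expr0 addrAC subrr add0r.
apply: wt_sum => k _; apply: wtZ; rewrite lift0.
by apply: (@wtW _ _ _ _ (1 * k.+1)) => //; apply: wtX.
Qed.

(** Every word in the expansion of the difference contains [B] at least once, contributing [r.+1],
    and each of its [k] other letters contributes at least [1]. *)
Lemma wt_exprD_sub (A B : mx) r k : dwt 1 A -> dwt r.+1 B ->
  dwt (r + k.+1) ((A + B) ^+ k.+1 - A ^+ k.+1).
Proof.
move=> hA hB; elim: k => [|k IH]; first by rewrite !expr1 addrAC subrr add0r addn1.
have -> : (A + B) ^+ k.+2 - A ^+ k.+2 =
    (A + B) * ((A + B) ^+ k.+1 - A ^+ k.+1) + B * A ^+ k.+1.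
  by rewrite mulrBr -exprS mulrDl -exprS opprD addrA subrK.
apply: wtD.
  apply: (@wtW _ _ _ _ (1 + (r + k.+1))); first by lia.
  by apply: wtM => //; apply: wtD => //; apply: wtW hB.
have h := wtX (k := k.+1) hA; rewrite mul1n in h.
by apply: wtW (wtM hB h); lia.
Qed.

(** Successive approximation: adding the error [g - mexp A] to [A] cancels it in the linear term of
    the series, and by [wt_exprD_sub] the terms of degree at least 2 only change in higher
    weight. *)
Lemma mexp_surj (g : mx) : dwt 1 (g - 1) -> exists A, dwt 1 A /\ g = mexp A.
Proof.
move=> hg.
have approx r : exists A, dwt 1 A /\ dwt r.+1 (g - mexp A).
  elim: r => [|r [A [hA hB]]].
    exists 0; split; first exact: wt0.
    have -> : g - mexp 0 = (g - 1) - (mexp 0 - 1) by rewrite opprB addrA subrK.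
    by apply: wtB => //; apply: mexp_unip; apply: wt0.
  exists (A + (g - mexp A)); split; first by apply: wtD => //; apply: wtW hB.
  have -> : g - mexp (A + (g - mexp A)) =
      - (mexp (A + (g - mexp A)) - mexp A - (g - mexp A)).
    by set x := mexp (A + _); rewrite opprB opprB addrA subrK.
  apply: wtN; move: (g - mexp A) hB => B hB; rewrite /mexp -sumrB big_ord_recl [X in X + _ - _](_ : _ = 0); last first.
    by rewrite !expr0 subrr.
  rewrite add0r big_ord_recl addrAC [X in X + _](_ : _ = 0); last first.
    by rewrite !lift0 !expr1 factS fact0 invr1 !scale1r addrAC addrK subrr.
  rewrite add0r; apply: wt_sum => k _; rewrite -scalerBr; apply: wtZ; rewrite !lift0.
  have := wt_exprD_sub (k := k.+1) hA hB; apply: wtW; lia.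
have [A [hA hgA]] := approx N; exists A; split=> //; apply/eqP; rewrite -subr_eq0; apply/eqP; apply: wt_gt hgA => a.
by rewrite ltnS leq_subr.
Qed.

End Exponential.

(** * The Mal'cev basis, lattice and filtration of the unitriangular group *)

Section Malcev.
Variables (R : realType) (N D : nat) (phi : 'I_N.+1 -> nat).
Variable e : 'I_D -> 'I_N.+1 * 'I_N.+1.
Local Notation mx := ('M[R]_N.+1).
Local Notation wt := (wt phi).
Local Notation w k := (phi (e k).1 - phi (e k).2)%N.
Hypothesis phi_lacunary : forall a b : 'I_N.+1, (a < b)%N -> (2 * phi b < phi a)%N.
Hypothesis e_inj : injective e.
Hypothesis e_lt : forall k, ((e k).1 < (e k).2)%N.
Hypothesis e_surj : forall a b : 'I_N.+1, (a < b)%N -> exists k, e k = (a, b).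
Hypothesis e_mono : forall k l : 'I_D, (k <= l)%N -> (w k <= w l)%N.

Definition malcev_basis (k : 'I_D) : mx := delta_mx (e k).1 (e k).2.
Local Notation X := malcev_basis.

Lemma phi_anti (a b : 'I_N.+1) : (b <= a)%N -> (phi a <= phi b)%N.
Proof.
rewrite leq_eqVlt => /orP [/eqP/val_inj -> //|/phi_lacunary]; lia.
Qed.

Lemma wt1P (A : mx) : wt 1 A <-> strictly_upper A.
Proof.
split=> h a b hab; apply: h; first by rewrite addn1 ltnS phi_anti.
rewrite leqNgt; apply/negP => /phi_lacunary; lia.
Qed.

Lemma e_lt_w k l : (w k < w l)%N -> (k < l)%N.
Proof. by move=> h; rewrite ltnNge; apply/negP => /e_mono; lia. Qed.

Lemma basisE k a b : X k a b = ((a, b) == e k)%:R.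
Proof. by rewrite mxE; case: (e k). Qed.

Lemma basis_sum_entry (P : pred 'I_D) (t : 'I_D -> R) k :
  (\sum_(l < D | P l) t l *: X l) (e k).1 (e k).2 = if P k then t k else 0.
Proof.
rewrite summxE; have E l : (t l *: X l) (e k).1 (e k).2 = t l * (k == l)%:R.
  by rewrite mxE basisE -surjective_pairing (inj_eq e_inj).
case: ifP => h.
  rewrite (bigD1 k) //= E eqxx mulr1 big1 ?addr0 // => l /andP [_ /negPf hl].
  by rewrite E eq_sym hl mulr0.
rewrite big1 // => l hl; rewrite E; case: eqP => [hkl|_]; last by rewrite mulr0.
by move: h; rewrite hkl hl.
Qed.

Lemma basis_sum_upper (P : pred 'I_D) (t : 'I_D -> R) :
  strictly_upper (\sum_(l < D | P l) t l *: X l).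
Proof.
move=> a b hab; rewrite summxE big1 // => l _; rewrite mxE basisE.
by case: eqP => [h|]; rewrite ?mulr0 //; have := e_lt l; rewrite -h /=; lia.
Qed.

Lemma upper_eq (A B : mx) : strictly_upper A -> strictly_upper B ->
  (forall k, A (e k).1 (e k).2 = B (e k).1 (e k).2) -> A = B.
Proof.
move=> hA hB h; apply/matrixP => a b; case: (leqP b a) => hab; first by rewrite hA ?hB.
by have [k ek] := e_surj hab; have := h k; rewrite ek.
Qed.

Lemma span_fromP j A : span_from X j A <->
  strictly_upper A /\ forall k : 'I_D, (k < j)%N -> A (e k).1 (e k).2 = 0.
Proof.
split=> [[c [hc ->]]|[hA h]].
  split; first exact: (basis_sum_upper xpredT).
  by move=> k hk; rewrite (basis_sum_entry xpredT) hc.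
exists (fun k => A (e k).1 (e k).2); split=> //; apply: upper_eq => //.
  exact: (basis_sum_upper xpredT).
by move=> k; rewrite (basis_sum_entry xpredT).
Qed.

(** An entry [(a,b)] of the product sums over [a < c < b]. The entries [(a,c)] and [(c,b)] have
    smaller weight than [(a,b)], hence smaller index, and there [B] vanishes. *)
Lemma span_mul_ideal j A B (k : 'I_D) : strictly_upper A -> span_from X j B -> (k < j)%N ->
  (A * B) (e k).1 (e k).2 = 0 /\ (B * A) (e k).1 (e k).2 = 0.
Proof.
move=> hA /span_fromP [hB hj] hk; split; rewrite mxE big1 // => c _.
  case: (leqP c (e k).1) => h1; first by rewrite hA // mul0r.
  case: (leqP (e k).2 c) => h2; first by rewrite hB // mulr0.
  have [l el] := e_surj h2; have := hj l; rewrite el /= => -> //; first by rewrite mulr0.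
  apply: leq_ltn_trans hk; apply/ltnW/e_lt_w; rewrite el /=.
  have := phi_lacunary h1; have := phi_lacunary h2; lia.
case: (leqP c (e k).1) => h1; first by rewrite hB // mul0r.
case: (leqP (e k).2 c) => h2; first by rewrite hA // mulr0.
have [l el] := e_surj h1; have := hj l; rewrite el /= => -> //; first by rewrite mul0r.
apply: leq_ltn_trans hk; apply/ltnW/e_lt_w; rewrite el /=.
have := phi_lacunary h1; have := phi_lacunary h2; lia.
Qed.

Lemma upper_mul A B : strictly_upper A -> strictly_upper B -> strictly_upper (A * B : mx).
Proof.
by move=> /wt1P hA /wt1P hB; apply/wt1P; apply: wtW (wtM hA hB).
Qed.

Lemma malcev_basis_nilpotent : nilpotent_lie_basis X.
Proof.
split=> [k a b hab|c hc k|j A B /span_fromP [hA _] hB].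
- by rewrite basisE; case: eqP => // h; have := e_lt k; rewrite -h /=; lia.
- by have := basis_sum_entry xpredT c k; rewrite hc mxE.
have [hB' _] := (span_fromP j B).1 hB.
apply/span_fromP; split=> [a b hab|k hk].
  by have := upper_mul hA hB' hab; have := upper_mul hB' hA hab;
    rewrite !mxE => -> ->; rewrite subr0.
by have [] := span_mul_ideal hA hB hk; rewrite !mxE => -> ->; rewrite subr0.
Qed.

(** A nonzero product needs [e k = (a,c)] and [e l = (c,b)]. Lacunarity then gives
    [phi a - phi c > phi c >= phi c - phi b], contradicting the ordering by weight. *)
Lemma basis_mul0 (k l : 'I_D) : (k <= l)%N -> X k * X l = 0.
Proof.
move=> hkl; apply/matrixP => a b; rewrite !mxE big1 // => c _; rewrite !basisE.
case: eqP => [hk|]; last by rewrite mul0r.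
case: eqP => [hl|]; last by rewrite mulr0.
have := e_mono hkl; have := e_lt k; have := e_lt l; rewrite -hk -hl /=.
by move=> h1 h2; have := phi_lacunary h1; have := phi_lacunary h2; lia.
Qed.

Lemma mexp_basis t k : mexp (t *: X k) = 1 + t *: X k.
Proof.
rewrite /mexp !big_ord_recl !lift0 factS fact0 !invr1 !scale1r expr0 expr1 big1 ?addr0 //.
move=> i _; rewrite !lift0 exprS exprS mulrA -scalerAl -scalerAr basis_mul0 //.
by rewrite !scaler0 mul0r scaler0.
Qed.

(* No product [X k * X l] with [k < l] survives, so Mal'cev coordinates of the
   second kind are the matrix entries. *)
Lemma malcev_prodE j t : malcev_prod X j t = 1 + \sum_(k < D | (j <= k)%N) t k *: X k.
Proof.
rewrite /malcev_prod -big_filter -[in RHS]big_filter.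
have tr : transitive (fun k l : 'I_D => k < l)%N by move=> x y z; apply: ltn_trans.
have : sorted (fun k l : 'I_D => k < l)%N [seq k : 'I_D <- index_enum 'I_D | (j <= k)%N].
  rewrite sorted_filter //.
  have := iota_ltn_sorted 0 D; rewrite -val_enum_ord sorted_map.
  by rewrite [index_enum _]unlock -enumT.
elim: (filter _ _) => [|k s IH] srt; first by rewrite !big_nil addr0.
rewrite !big_cons {}IH ?(path_sorted srt) //.
rewrite mexp_basis mulrDl mul1r mulrDr mulr1.
rewrite [X in _ + (_ + X)](_ : _ = 0) ?addr0 1?addrAC ?addrA //.
rewrite mulr_sumr big_seq big1 // => l hl.
rewrite -scalerAl -scalerAr basis_mul0 ?scaler0 //; apply: ltnW.
by have /allP := order_path_min tr srt; apply.
Qed.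

Lemma malcev_prod_entry j t k :
  malcev_prod X j t (e k).1 (e k).2 = if (j <= k)%N then t k else 0.
Proof.
rewrite malcev_prodE mxE (basis_sum_entry (fun k : 'I_D => j <= k)%N) mxE.
by case: eqP => [h|]; rewrite ?add0r //; have := e_lt k; rewrite h ltnn.
Qed.

Lemma malcev_prod_unip j t : wt 1 (malcev_prod X j t - 1).
Proof.
apply/wt1P; rewrite malcev_prodE addrAC subrr add0r.
exact: (basis_sum_upper (fun k : 'I_D => j <= k)%N).
Qed.

Lemma unip_eq (g h : mx) : wt 1 (g - 1) -> wt 1 (h - 1) ->
  (forall k, g (e k).1 (e k).2 = h (e k).1 (e k).2) -> g = h.
Proof.
move=> /wt1P hg /wt1P hh E; apply: (addIr (- 1)); apply: upper_eq => // k.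
by rewrite mxE E [RHS]mxE.
Qed.

Lemma malcev_prod0E (g : mx) : wt 1 (g - 1) ->
  g = malcev_prod X 0 (fun k => g (e k).1 (e k).2).
Proof.
move=> hg; apply: unip_eq => //; first exact: malcev_prod_unip.
by move=> k; rewrite malcev_prod_entry.
Qed.

Lemma lie_groupP (g : mx) : lie_group X g <-> wt 1 (g - 1).
Proof.
split=> [[A [/span_fromP [hA _] ->]]|/wt1P/dwt1P/mexp_surj [A [/dwt1P hA ->]]].
  by apply/wt1P/dwt1P/mexp_unip/dwt1P.
by exists A; split=> //; apply/span_fromP.
Qed.

Lemma unip_utri (g : mx) : wt 1 (g - 1) <-> utri g.
Proof.
split=> [h|[h0 h1] a b hab].
  split=> [a b hab|a].
    have := h a b; rewrite !mxE (negPf (_ : a != b)) ?subr0; last first.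
      by apply/eqP => E; move: hab; rewrite E ltnn.
    by apply; rewrite addn1 ltnS phi_anti // ltnW.
  by have := h a a; rewrite !mxE eqxx => /(_ _)/subr0_eq -> //; rewrite addn1.
rewrite !mxE; case: eqP => [->|]; first by rewrite h1 subrr.
move=> ne; rewrite subr0 h0 // ltnNge; apply/negP; rewrite leq_eqVlt => /orP [/eqP/val_inj //|].
by move/phi_lacunary; lia.
Qed.

(** As the basis is sorted by weight, the elements of weight at least [i] form a tail; [find]
    returns [D] when that tail is empty. *)
Definition codim i := find (fun k => i <= w k)%N (enum 'I_D).

Lemma codimP i (k : 'I_D) : (codim i <= k)%N = (i <= w k)%N.
Proof.
have kE : nth k (enum 'I_D) k = k by rewrite nth_ord_enum.
apply/idP/idP => [h|h].
  have hD : (codim i < D)%N by apply: leq_ltn_trans h _.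
  have := @nth_find _ k (fun k => i <= w k)%N (enum 'I_D).
  rewrite has_find size_enum_ord => /(_ hD) h'; apply: (leq_trans h').
  by apply: e_mono; rewrite -/(codim i) (nth_enum_ord k hD).
rewrite leqNgt; apply/negP => /(before_find k); rewrite kE h //.
Qed.

Lemma unip_malcevP i (g : mx) : wt (maxn i 1) (g - 1) <-> exists t, g = malcev_prod X (codim i) t.
Proof.
split=> [h|[t ->] a b].
  have h1 : wt 1 (g - 1) by apply: wtW h; lia.
  exists (fun k => g (e k).1 (e k).2); apply: unip_eq => //; first exact: malcev_prod_unip.
  move=> k; rewrite malcev_prod_entry; case: ifP => //; rewrite codimP => /negbT hk.
  have := h (e k).1 (e k).2; rewrite !mxE.
  case: eqP => [E|_]; first by have := e_lt k; rewrite E ltnn.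
  by rewrite subr0; apply; have := phi_lacunary (e_lt k); lia.
case: (leqP b a) => hab h; first by apply: (wt1P _).1 hab; apply: malcev_prod_unip.
have [k ek] := e_surj hab; have := malcev_prod_entry (codim i) t k; rewrite codimP ek /=.
rewrite !mxE => ->; case: ifP => hi; first by move: h (phi_lacunary hab); lia.
by case: eqP => [E|_]; [move: hab; rewrite E ltnn | rewrite subr0].
Qed.

Lemma integral_unip (m : mx) : integral m -> wt 1 (m - 1).
Proof. by move=> [u _]; apply/unip_utri. Qed.

Lemma integralM (g h : mx) : integral g -> integral h -> integral (g * h).
Proof.
move=> hg hh; split; first by apply/unip_utri/unipM => //; apply: integral_unip.
by move=> a b; rewrite mxE rpred_sum // => c _; rewrite rpredM ?hg.2 ?hh.2.
Qed.

Lemma integralV (g : mx) : integral g -> integral g^-1.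
Proof.
move=> hg; have ug := integral_unip hg.
split; first by apply/unip_utri/unipV.
have [k hk] := unip_bound phi; rewrite (unip_invE ug hk) => a b.
rewrite summxE rpred_sum // => i _.
elim: (i : nat) a b => [|j IH] a b; first by rewrite expr0 mxE natr_int.
by rewrite exprS mxE rpred_sum // => c _; rewrite rpredM // !mxE rpredB ?natr_int ?hg.2.
Qed.

Lemma malcev_latticeP (g : mx) : malcev_lattice X g <-> integral g.
Proof.
split=> [[z ->]|hg].
  have u : utri (malcev_prod X 0 (fun k => (z k)%:~R)) by apply/unip_utri/malcev_prod_unip.
  split=> // a b; case: (ltngtP a b) => [h|h|/val_inj ->].
  - have [k ek] := e_surj h; have := malcev_prod_entry 0 (fun k => (z k)%:~R) k.
    by rewrite ek /= => ->; rewrite intr_int.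
  - by rewrite u.1.
  - by rewrite u.2.
exists (fun k => Num.floor (g (e k).1 (e k).2)).
rewrite {1}(malcev_prod0E (integral_unip hg)); congr malcev_prod.
by apply: funext => k; rewrite floorK ?hg.2.
Qed.

Lemma mul_transvection (g : mx) k t a b :
  (g * (1 - t *: X k)) a b = g a b - (if b == (e k).2 then t * g a (e k).1 else 0).
Proof.
rewrite mulrBr mulr1 -scalerAr !mxE; congr (_ - _).
case: ifP => h.
  rewrite (bigD1 (e k).1) //= big1 ?addr0 => [|c /negPf hc].
    by rewrite basisE (eqP h) -surjective_pairing eqxx mulr1.
  rewrite basisE; case: eqP => [E|]; last by rewrite mulr0.
  by move: hc; rewrite -E eqxx.
rewrite big1 ?mulr0 // => c _; rewrite basisE; case: eqP => [E|]; last by rewrite mulr0.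
by move: h; rewrite -E eqxx.
Qed.

(* Clearing the entry [e j] by a column operation only changes entries of larger
   weight in the same column. *)
Lemma unip_factor (g : mx) : wt 1 (g - 1) ->
  exists k m, [/\ reduced k, integral m & g = k * m].
Proof.
move=> hg.
have approx j : exists m : mx, integral m /\
    forall k : 'I_D, (k < j)%N -> 0 <= (g * m) (e k).1 (e k).2 < 1.
  elim: j => [|j [m [im hm]]].
    exists 1; split=> //; split; first by apply/unip_utri; rewrite subrr; apply: wt0.
    by move=> a b; rewrite mxE natr_int.
  case: (ltnP j D) => hj; last first.
    by exists m; split=> // k _; apply: hm; apply: leq_trans hj.
  set j' := Ordinal hj; set t := (g * m) (e j').1 (e j').2.
  have ugm : utri (g * m) by apply/unip_utri/unipM => //; apply: integral_unip.
  exists (m * (1 - (Num.floor t)%:~R *: X j')); split.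
    apply: integralM => //; split.
      apply/unip_utri; rewrite addrAC subrr add0r; apply/wtN/wtZ/wt1P => a b hab.
      by rewrite basisE; case: eqP => // h; have := e_lt j'; rewrite -h /=; lia.
    move=> a b; rewrite !mxE rpredB ?natr_int // rpredM ?intr_int //.
    exact: (natr_int _ ((a == _) && (b == _))).
  move=> k; rewrite ltnS mulrA mul_transvection => hk.
  case: eqP => [E|ne].
    case: (ltngtP (e k).1 (e j').1) => h.
    - exfalso; have := @e_mono k j' hk; rewrite E.
      by have := phi_lacunary h; have := phi_lacunary (e_lt j'); lia.
    - rewrite (ugm.1 (e k).1 (e j').1) // mulr0 subr0 hm // ltn_neqAle hk andbT.
      by apply/eqP => Ek; have kj : k = j' by [apply: val_inj]; move: h; rewrite kj ltnn.
    - have -> : k = j'.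
        by apply: e_inj; rewrite [e k]surjective_pairing [RHS]surjective_pairing E (val_inj h).
      by rewrite ugm.2 mulr1 -/t; apply: fpart_itv.
  rewrite subr0; move: hk; rewrite leq_eqVlt => /orP [/eqP hk|]; last exact: hm.
  by case: ne; have -> : k = j' by apply: val_inj.
have [m [im hm]] := approx D.
have um : m \is a GRing.unit by apply: unip_unit (integral_unip im).
exists (g * m), m^-1; split; last by rewrite mulrK.
  split; first by apply/unip_utri/unipM => //; apply: integral_unip.
  by move=> a b hab; have [k ek] := e_surj hab; have := hm k (ltn_ord k); rewrite ek.
exact: integralV.
Qed.

(** Induction on the distance to the diagonal: once the nearer entries of [m] vanish,
    [k a b = k' a b + m a b], so the integer [m a b] is a difference of two numbers in [[0,1)]. *)
Lemma reduced_mul_integral (k k' m : mx) : reduced k -> reduced k' -> integral m ->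
  k = k' * m -> m = 1.
Proof.
move=> rk rk' im E.
have off r : forall a b : 'I_N.+1, (a < b)%N -> (b - a <= r)%N -> m a b = 0.
  elim: r => [|r IH] a b hab hr; first by move: hab hr; lia.
  have : k a b = k' a b + m a b.
    rewrite E mxE (bigD1 a) //= (bigD1 b) /=; last by rewrite neq_ltn hab orbT.
    rewrite rk'.1.2 im.1.2 mul1r mulr1 big1 ?addr0 1?addrC // => c /andP [ca cb].
    case: (ltngtP c a) => h; first by rewrite rk'.1.1 // mul0r.
      case: (ltngtP c b) => h'; last by rewrite (val_inj h') eqxx in cb.
        by rewrite IH ?mulr0 //; lia.
      by rewrite im.1.1 // mulr0.
    by rewrite (val_inj h) eqxx in ca.
  have := rk.2 a b hab; have := rk'.2 a b hab.
  have /intrP [z ->] := im.2 a b => /andP [h1 h2] /andP [h3 h4] h5.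
  have z1 : (-1)%:~R < z%:~R :> R by rewrite mulrN1z; lra.
  have z2 : z%:~R < 1%:~R :> R by lra.
  move: z1 z2; rewrite !ltr_int => z1 z2.
  by have -> : z = 0 by lia.
apply/matrixP => a b; rewrite mxE; case: (ltngtP a b) => [h|h|/val_inj ->].
- rewrite (off _ a b h (leqnn _)); case: eqP => // E'; by move: h; rewrite E' ltnn.
- rewrite im.1.1 //; case: eqP => // E'; by move: h; rewrite E' ltnn.
- by rewrite im.1.2 eqxx.
Qed.

Lemma reduced_uniq (k k' m m' : mx) : reduced k -> reduced k' ->
  integral m -> integral m' -> k * m = k' * m' -> k = k'.
Proof.
move=> rk rk' im im' E; have um : m \is a GRing.unit by apply: unip_unit (integral_unip im).
have E' : k = k' * (m' * m^-1) by rewrite mulrA -E mulrK.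
have := reduced_mul_integral rk rk' (integralM im' (integralV im)) E'.
by move=> h; rewrite E' h mulr1.
Qed.

Lemma malcev_is_lattice : is_lattice X (malcev_lattice X).
Proof.
split.
- split=> [g /malcev_latticeP /integral_unip /lie_groupP //||g h|g].
  + apply/malcev_latticeP; split; first by apply/unip_utri; rewrite subrr; apply: wt0.
    by move=> a b; rewrite mxE natr_int.
  + by move=> /malcev_latticeP hg /malcev_latticeP hh; apply/malcev_latticeP/integralM.
  + by move=> /malcev_latticeP hg; apply/malcev_latticeP/integralV.
(* Radius [1] isolates the identity because the entries of [g - 1] are integers. *)
- exists 1; split=> // g /malcev_latticeP hg h; apply/eqP; rewrite -subr_eq0; apply/eqP.
  apply/matrixP => a b; rewrite [RHS]mxE; apply/eqP; have := h a b.
  apply: contraTT => h0; rewrite -leNgt norm_intr_ge1 //.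
  by rewrite !mxE rpredB ?hg.2 ?natr_int.
exists 1 => g /lie_groupP /unip_factor [k [m [rk im E]]]; exists k, m; split=> //.
- by apply/lie_groupP/unip_utri; case: rk.
- exact/malcev_latticeP.
- by move=> a b; have := reduced_itv01 a b rk => /andP [h0 h1]; rewrite ger0_norm.
Qed.

Lemma malcev_filtration s : (forall a, phi a <= s)%N ->
  filtration X s (fun i g => wt (maxn i 1) (g - 1)).
Proof.
move=> hs; split.
- by split=> g; rewrite ?maxnn ?max0n; split=> /lie_groupP.
- move=> i; split=> [g h||g h hg hh|g hg].
  + by apply/lie_groupP; apply: wtW h; lia.
  + by rewrite subrr; apply: wt0.
  + by apply: unipM => //; lia.
  + by apply: unipV => //; lia.
- by move=> i g; apply: wtW; lia.
- move=> i g hi; split=> [h|->]; last by rewrite subrr; apply: wt0.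
  apply/eqP; rewrite -subr_eq0; apply/eqP; apply: wt_gt h => a.
  by have := hs a; lia.
- move=> i j g h hg hh; apply: wtW (unip_comm _ _ hg hh); lia.
Qed.

Lemma malcev_basis_compatible :
  malcev_compatible X (fun i g => wt (maxn i 1) (g - 1)) codim.
Proof.
split=> [|i|i g|i t t' E k hk].
- exact: malcev_basis_nilpotent.
- by rewrite /codim (leq_trans (find_size _ _)) // size_enum_ord.
- exact: unip_malcevP.
- by have := malcev_prod_entry (codim i) t k; rewrite E malcev_prod_entry hk.
Qed.

End Malcev.

(** * Listing the positions above the diagonal by weight *)

Lemma pair_enumeration N (phi : 'I_N.+1 -> nat) : exists D (e : 'I_D -> 'I_N.+1 * 'I_N.+1),
  [/\ injective e, forall k, ((e k).1 < (e k).2)%N,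
      forall a b : 'I_N.+1, (a < b)%N -> exists k, e k = (a, b)
    & forall k l : 'I_D, (k <= l)%N ->
        (phi (e k).1 - phi (e k).2 <= phi (e l).1 - phi (e l).2)%N].
Proof.
pose w (p : 'I_N.+1 * 'I_N.+1) := (phi p.1 - phi p.2)%N.
pose s := sort (relpre w leq) (enum [pred p : 'I_N.+1 * 'I_N.+1 | (p.1 < p.2)%N]).
have us : uniq s by rewrite sort_uniq enum_uniq.
have ms p : (p \in s) = (p.1 < p.2)%N by rewrite mem_sort mem_enum.
exists (size s), (tnth (in_tuple s)); split.
- exact/tuple_uniqP.
- by move=> k; rewrite -ms mem_tnth.
- by move=> a b hab; have /tnthP [k ->] : (a, b) \in in_tuple s by [rewrite ms]; exists k.
- move=> k l hkl; have tr : transitive (relpre w leq) by move=> x y z; apply: leq_trans.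
  have re : reflexive (relpre w leq) by move=> x /=.
  have srt : sorted (relpre w leq) s by apply: sort_sorted => x y /=; apply: leq_total.
  have x0 := tnth (in_tuple s) k.
  rewrite !(tnth_nth x0) /=.
  by apply: (sorted_leq_nth tr re x0 srt) => //; rewrite inE ltn_ord.
Qed.

Import (canonicals) mpoly.

(** * Functions that are polynomial on each sign pattern *)

Section SignPatterns.
Variables (R : realType) (D : nat).
Local Notation mp := (mpoly.mpoly D R).

Definition sign_of (x : R) : option bool :=
  if x == 0 then None else Some (0 < x).

Definition sign_pattern (J : finType) (Q : J -> mp) (t : 'I_D -> R) : {ffun J -> option bool} :=
  [ffun j => sign_of (mpoly.meval t (Q j))].

(** An arbitrary finite index type lets two families of test polynomials be merged by a sum type. *)
Definition pattern_poly (u : ('I_D -> R) -> R) :=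
  exists (J : finType) (Q : J -> mp) (Phi : {ffun J -> option bool} -> mp),
    forall t, u t = mpoly.meval t (Phi (sign_pattern Q t)).

Lemma pattern_poly_mpoly (p : mp) : pattern_poly (fun t => mpoly.meval t p).
Proof. by exists void, (fun _ => 0), (fun _ => p). Qed.

Lemma pattern_poly2 (op : R -> R -> R) (opp : mp -> mp -> mp) u v :
  (forall t p q, mpoly.meval t (opp p q) = op (mpoly.meval t p) (mpoly.meval t q)) ->
  pattern_poly u -> pattern_poly v -> pattern_poly (fun t => op (u t) (v t)).
Proof.
move=> hop [J1 [Q1 [Phi1 E1]]] [J2 [Q2 [Phi2 E2]]].
exists (J1 + J2)%type, (fun j => match j with inl j => Q1 j | inr j => Q2 j end).
exists (fun s => opp (Phi1 [ffun j => s (inl j)]) (Phi2 [ffun j => s (inr j)])) => t.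
rewrite hop E1 E2; congr (op (mpoly.meval _ (Phi1 _)) (mpoly.meval _ (Phi2 _)));
  by apply/ffunP => j; rewrite !ffunE.
Qed.

(** All candidate values [Phi s] are added to the test polynomials. The old signs tell which
    candidate equals [u], and the new signs give the sign of that candidate. *)
Lemma pattern_poly_step u : pattern_poly u -> pattern_poly (fun t => (0 <= u t)%R%:R).
Proof.
move=> [J [Q [Phi E]]].
exists (J + {ffun J -> option bool})%type.
exists (fun j => match j with inl j => Q j | inr s => Phi s end).
exists (fun s => (s (inr [ffun j => s (inl j)]) != Some false)%:R) => t.
rewrite mpoly.mevalMn; set s := [ffun j => _].
have -> : s = sign_pattern Q t by apply/ffunP => j; rewrite !ffunE.
rewrite ffunE -E /sign_of mpoly.meval1; congr (_ *+ (_ : bool)).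
by case: (ltgtP 0 (u t)).
Qed.

(** Each [j] occurs in both lists; where it imposes no condition, the fillers [1] and [0] give
    [1 > 0] and [0 = 0]. *)
Definition pattern_set (J : finType) (Q : J -> mp) (s : {ffun J -> option bool}) : semialg R D :=
  [:: ([seq (match s j with Some true => Q j | Some false => - Q j | None => 1 end) | j <- enum J],
       [seq (match s j with None => Q j | _ => 0 end) | j <- enum J])].

Lemma in_pattern_set (J : finType) (Q : J -> mp) s t :
  in_semialg (pattern_set Q s) t = (s == sign_pattern Q t).
Proof.
rewrite /in_semialg /= orbF; apply/idP/eqP => [/andP [/allP h1 /allP h2]|->].
  apply/ffunP => j; rewrite ffunE /sign_of.
  have hj := mem_enum J j.
  have := h1 _ (map_f (fun j => match s j with Some true => Q j | Some false => - Q j | None => 1 end) hj).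
  have := h2 _ (map_f (fun j => match s j with None => Q j | _ => 0 end) hj).
  case: (s j) => [[]|]; rewrite ?mpoly.mevalN ?oppr_gt0 => hA hB.
  - by rewrite gt_eqF hB.
  - by rewrite lt_eqF // ltNge ltW.
  - by rewrite hA.
apply/andP; split; apply/allP => x /mapP [j _ ->]; rewrite ffunE /sign_of.
  case: (ltgtP (mpoly.meval t (Q j)) 0) => h; rewrite ?mpoly.mevalN ?oppr_gt0 ?mpoly.meval1 ?ltr01 //.
case: (boolP (mpoly.meval t (Q j) == 0)) => // _; by rewrite mpoly.meval0.
Qed.

End SignPatterns.

(** * From piecewise functions of entries to piecewise polynomial maps *)

Section PiecewisePolynomial.
Variables (R : realType) (N D : nat) (phi : 'I_N.+1 -> nat).
Variable e : 'I_D -> 'I_N.+1 * 'I_N.+1.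
Hypothesis phi_lacunary : forall a b : 'I_N.+1, (a < b)%N -> (2 * phi b < phi a)%N.
Hypothesis e_inj : injective e.
Hypothesis e_lt : forall k, ((e k).1 < (e k).2)%N.
Hypothesis e_surj : forall a b : 'I_N.+1, (a < b)%N -> exists k, e k = (a, b).
Hypothesis e_mono : forall k l : 'I_D, (k <= l)%N ->
  (phi (e k).1 - phi (e k).2 <= phi (e l).1 - phi (e l).2)%N.
Local Notation X := (malcev_basis R e).

Lemma pattern_poly_piecewise (u : 'M[R]_N.+1 -> R) :
  piecewise u -> pattern_poly (fun t => u (malcev_prod X 0 t)).
Proof.
elim=> {u} [c|i j|u v _ hu _ hv|u v _ hu _ hv|u _ hu].
- have [J [Q [Phi E]]] := pattern_poly_mpoly (mpoly.mpolyC D c).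
  by exists J, Q, Phi => t; rewrite -E mpoly.mevalC.
- have cst c : pattern_poly (fun _ : 'I_D -> R => c).
    have [J [Q [Phi E]]] := pattern_poly_mpoly (mpoly.mpolyC D c).
    by exists J, Q, Phi => t; rewrite -E mpoly.mevalC.
  have ut t : utri (malcev_prod X 0 t).
    by apply/(unip_utri phi_lacunary)/(malcev_prod_unip phi_lacunary e_lt e_mono).
  case: (ltngtP i j) => h.
  + have [k ek] := e_surj h.
    have [J [Q [Phi E]]] := pattern_poly_mpoly (mpoly.mpolyX R (mpoly.mnm1 k)).
    exists J, Q, Phi => t; rewrite -E mpoly.mevalXU.
    by have := malcev_prod_entry phi_lacunary e_inj e_lt e_mono 0 t k; rewrite ek.
  + have [J [Q [Phi E]]] := cst 0.
    by exists J, Q, Phi => t; rewrite -E (ut t).1.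
  + have [J [Q [Phi E]]] := cst 1.
    by exists J, Q, Phi => t; rewrite -E (val_inj h) (ut t).2.
- by apply: (pattern_poly2 (op := +%R) _ hu hv) => t p q; apply: mpoly.mevalD.
- by apply: (pattern_poly2 (op := *%R) _ hu hv) => t p q; apply: mpoly.mevalM.
- exact: pattern_poly_step.
Qed.

Lemma reduced_malcev_prod t : unit_cube t -> reduced (malcev_prod X 0 t).
Proof.
move=> ht; split.
  by apply/(unip_utri phi_lacunary)/(malcev_prod_unip phi_lacunary e_lt e_mono).
move=> a b hab; have [k ek] := e_surj hab.
by have := malcev_prod_entry phi_lacunary e_inj e_lt e_mono 0 t k; rewrite ek /= => ->.
Qed.

(** The pieces are indexed by all sign patterns, since each point realises exactly one. *)
Lemma piecewise_poly_of_piecewise (u F : 'M[R]_N.+1 -> R) : piecewise u ->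
  (forall k m, reduced k -> integral m -> F (k * m) = u k) -> piecewise_poly X F.
Proof.
move=> hu hF; have [J [Q [Phi E]]] := pattern_poly_piecewise hu.
exists #|{ffun J -> option bool}|, (fun i => pattern_set Q (enum_val i)).
exists (fun i => Phi (enum_val i)) => t ht; exists (enum_rank (sign_pattern Q t)).
split=> [|i|m hm]; first by rewrite in_pattern_set enum_rankK.
  by rewrite in_pattern_set => /eqP <-; rewrite enum_valK.
rewrite enum_rankK -E; apply: hF; first exact: reduced_malcev_prod.
exact/(malcev_latticeP phi_lacunary e_inj e_lt e_surj e_mono).
Qed.

End PiecewisePolynomial.

(** * Descent to the nilmanifold and conclusion *)

Lemma exists_factor_fun (R : realType) N (phi : 'I_N.+1 -> nat) (u : 'M[R]_N.+1 -> R) :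
  (forall a b : 'I_N.+1, (a < b)%N -> (2 * phi b < phi a)%N) ->
  exists F : 'M[R]_N.+1 -> R,
    forall k m, reduced k -> integral m -> F (k * m) = u k.
Proof.
move=> hphi; have [D [e [e_inj e_lt e_surj e_mono]]] := pair_enumeration phi.
have /choice [F hF] : forall g : 'M[R]_N.+1, exists y, forall k m,
    reduced k -> integral m -> g = k * m -> y = u k.
  move=> g; case: (pselect (exists k m, [/\ reduced k, integral m & g = k * m])).
    move=> [k [m [rk im E]]]; exists (u k) => k' m' rk' im' E'; congr u.
    by apply: (reduced_uniq hphi rk rk' im im'); rewrite -E.
  (* Matrices without a factorization get the default value [0]. *)
  by move=> h; exists 0 => k m rk im E; case: h; exists k, m.
by exists F => k m rk im; apply: hF rk im erefl.
Qed.

Theorem theorem4p4 (R : realType) (f : int -> R) :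
  gen_poly_map f -> bounded_map f -> forall d : nat,
  exists (N D : nat) (X : 'I_D -> 'M[R]_N.+1) (s : nat)
         (Gf : nat -> 'M[R]_N.+1 -> Prop) (Dc : nat -> nat)
         (F : 'M[R]_N.+1 -> R),
    [/\ is_lattice X (malcev_lattice X),
        filtration X s Gf,
        malcev_compatible X Gf Dc,
        piecewise_poly X F
      & forall p : {poly R}, (size p <= d.+1)%N ->
          exists gp : int -> 'M[R]_N.+1,
            poly_seq s Gf gp /\
            forall n : int, f (Num.floor p.[n%:~R]) = F (gp n)].
Proof.
move=> gf bf d; have [n [k [u [n_gt0 [G [dG uG eG]] pu Eu]]]] := gen_poly_nil_fun d gf bf.
case: n n_gt0 k u G dG uG eG pu Eu => // N _ k u G dG uG eG pu Eu.
have [B hB] : exists B, forall a b t, (size (G t a b) <= B)%N.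
  have /choice [Bf hBf] : forall ab, exists B, forall t, (size (G t ab.1 ab.2) <= B)%N.
    by move=> [a b]; apply: dG.
  exists (\max_ab Bf ab)%N => a b t; apply: leq_trans (hBf (a, b) t) _.
  exact: (leq_bigmax (a, b)).
(* For [a < b] this gives [2 * phi b + B.+1 <= phi a]: the weights are lacunary, and every weight
   above the diagonal exceeds the degree bound [B]. *)
pose phi (a : 'I_N.+1) := (B.+1 * (2 ^ (N - a) - 1))%N.
have pow2 (a b : 'I_N.+1) : (a < b)%N -> (2 * 2 ^ (N - b) <= 2 ^ (N - a))%N.
  by move=> h; rewrite -expnS leq_exp2l //; have := ltn_ord b; lia.
have phi_lac (a b : 'I_N.+1) : (a < b)%N -> (2 * phi b < phi a)%N.
  move=> /pow2; rewrite /phi; have := expn_gt0 2 (N - b).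
  by move: (2 ^ (N - b))%N (2 ^ (N - a))%N => /= x y; nia.
have phi_B (a b : 'I_N.+1) : (a < b)%N -> (B <= phi a - phi b)%N.
  move=> /pow2; rewrite /phi; have := expn_gt0 2 (N - b).
  by move: (2 ^ (N - b))%N (2 ^ (N - a))%N => /= x y; nia.
have [D [e [e_inj e_lt e_surj e_mono]]] := pair_enumeration phi.
have [F hF] := exists_factor_fun u phi_lac.
pose s := (\max_a phi a)%N.
have hs a : (phi a <= s)%N by apply: leq_bigmax.
exists N, D, (malcev_basis R e), s, (fun i g => wt phi (maxn i 1) (g - 1)), (codim phi e), F.
split.
- exact: (@malcev_is_lattice R N D phi e).
- exact: (@malcev_filtration R N D phi e).
- exact: (@malcev_basis_compatible R N D phi e).
- exact: (piecewise_poly_of_piecewise phi_lac e_inj e_lt e_surj e_mono pu hF).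
move=> p hp; pose t : {p : {poly R} | (size p <= d.+1)%N} := exist _ p hp.
(* The polynomial matrix itself is the sequence; [F] only sees its reduced factor [k t n]. *)
exists (fun n => evmx n (G t)); split; last first.
  move=> n; have [rk [m [im E]]] := eG t n.
  by rewrite -[LHS]/(f (Num.floor (val t).[n%:~R])) Eu E hF.
apply: poly_seq_of_poly_wt => // [a b|n].
  case: (ltngtP a b) => h.
  - split=> [|]; first by have := phi_lac _ _ h; lia.
    by apply: leq_trans (hB a b t) _; have := phi_B _ _ h; lia.
  - by rewrite (uG t).1 // size_poly0.
  - by rewrite (val_inj h) (uG t).2 ltnn size_poly1.
apply/(unip_utri phi_lac); split=> [a b h|a]; rewrite mxE /horner_eval.
  by rewrite (uG t).1 // horner0.
by rewrite (uG t).2 hornerC.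
Qed.
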